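(* Let $\mathcal{P}=\{u_1,\dots,u_{n_1}\}$ and $\mathcal{Q}=\{v_1,\dots,v_{n_2}\}$ be nonempty finite point sets in $\mathbb{R}^d$, let $P=(u_1,\dots,u_{n_1})$ and $Q=(v_1,\dots,v_{n_2})$ be the matrices with these columns, and let $n=n_1+n_2$. Consider the problems $$\text{(SVM)}\quad\max_{w\in\mathbb{R}^d,\ s_1,s_2\in\mathbb{R}}\{s_1+s_2:\ P^Tw-s_1\mathbf{1}\ge0,\ -Q^Tw-s_2\mathbf{1}\ge0,\ \|w\|_2\le1\},$$ $$\text{(PD)}\quad\min_{\mu\in\mathbb{R}^{n_1},\ \gamma\in\mathbb{R}^{n_2}}\{\|P\mu-Q\gamma\|_2:\ \mathbf{1}^T\mu=\mathbf{1}^T\gamma=1,\ \mu,\gamma\ge0\},$$ which have a common optimal value $\mathsf{OPT}$, and assume the separable case $\mathsf{OPT}>0$. Let $D$ be the maximum Euclidean norm of the points in $\mathcal{P}\cup\mathcal{Q}$, $E=D^2/\mathsf{OPT}^2$, and $\varepsilon\in(0,1]$. The primal-dual meta-algorithm applied to (SVM) (described in the context), which computes a $(1-\varepsilon)$-approximate solution to (SVM) and a $(1+\varepsilon)$-approximate solution to (PD), can be parallelized in the work-span model, and the parallel algorithm takes $O\Big(\frac{E\,nd\log n}{\varepsilon^2}\Big)$ work and has $O\Big(\frac{E\log(nd)\log n}{\varepsilon^2}\Big)$ span.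
   Context: Work-span model: a computation is a directed acyclic graph of elementary operations on real numbers (arithmetic, comparisons, square roots, exponentials); the work is the total number of operations and the span is the length of the longest path. Constants in $O(\cdot)$ are absolute. A $(1-\varepsilon)$-approximate solution to (SVM) is a feasible point with objective value at least $(1-\varepsilon)\mathsf{OPT}$; a $(1+\varepsilon)$-approximate solution to (PD) is a feasible point with objective value at most $(1+\varepsilon)\mathsf{OPT}$. $\mathbf{1}$ is the all-ones vector of the appropriate length. The meta-algorithm for this problem. The redundant constraints $s_1\le D$, $s_2\le D$ are added to (SVM). Feasibility test for a guess $\alpha\in(0,2D]$ and tolerance $\varepsilon'$: put $R=2$, $\rho=2D$, $T=\lceil4R^2\rho^2\ln n/(\varepsilon'^2\alpha^2)\rceil$, $\eta=\sqrt{\ln n/T}$. Start with $p^{(1)}=\frac1n\mathbf{1}\in\mathbb{R}^n_+$. In iteration $t=1,\dots,T$, write $p^{(t)}=(\mu^{(t)};\gamma^{(t)})$ with $\mu^{(t)}\in\mathbb{R}^{n_1}_+$, $\gamma^{(t)}\in\mathbb{R}^{n_2}_+$, and solve (in closed form) $$\max_{w,s_1,s_2}\ (P\mu^{(t)}-Q\gamma^{(t)})^Tw-(\mathbf{1}^T\mu^{(t)})s_1-(\mathbf{1}^T\gamma^{(t)})s_2\quad\text{s.t. }s_1+s_2\ge\alpha,\ \|w\|_2\le1,\ s_1,s_2\le D .$$ If the value is negative, conclude $\mathsf{OPT}<\alpha$, output $\big(\mu^{(t)}/(\mathbf{1}^T\mu^{(t)});\ \gamma^{(t)}/(\mathbf{1}^T\gamma^{(t)})\big)$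 as a solution of (PD), and terminate. Otherwise let $(w^{(t)},s_1^{(t)},s_2^{(t)})$ be the optimal solution found, let $\bar w^{(t)},\bar s_1^{(t)},\bar s_2^{(t)}$ be the averages over iterations $1,\dots,t$, and set $p^{(t+1)}=\frac1C\exp\big(-\frac{\eta t}{\rho}(P^T\bar w^{(t)}-\bar s_1^{(t)}\mathbf{1};\ -Q^T\bar w^{(t)}-\bar s_2^{(t)}\mathbf{1})\big)$ (entrywise exponential, $C$ normalizing the entries to sum to one). If there is no termination within $T$ iterations, output $(\bar w^{(T)},\ \bar s_1^{(T)}-\varepsilon'\alpha/2,\ \bar s_2^{(T)}-\varepsilon'\alpha/2)$ as a solution of (SVM), of value at least $(1-\varepsilon')\alpha$. Search over $\alpha$: starting from an interval $[L_0,U_0]=[0,2D]$ containing $\mathsf{OPT}$, repeatedly run the feasibility test with a guess $\alpha_i$ and tolerance $\varepsilon_i$ chosen so that $\varepsilon_i\alpha_i=\frac13(U_{i-1}-L_{i-1})$ and $[(1-\varepsilon_i)\alpha_i,\alpha_i]$ is the middle third of the current interval $[L_{i-1},U_{i-1}]$; if $\mathsf{OPT}<\alpha_i$ is concluded set $U_i=\alpha_i$, $L_i=L_{i-1}$, otherwise set $L_i=(1-\varepsilon_i)\alpha_i$, $U_i=U_{i-1}$; continue until $U_i-L_i$ is at most the desired additive error $\varepsilon\,\mathsf{OPT}$. The last solutions found for (SVM) and (PD) are returned (initially, $w=0,s_1=s_2=0$ for (SVM) and any feasible point for (PD)). *)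

(* Defs.v *)
From HB Require Import structures.
From mathcomp Require Import all_boot all_order all_algebra.
From mathcomp Require Import classical_sets reals sequences exp.

Set Implicit Arguments.
Unset Strict Implicit.
Unset Printing Implicit Defensive.
Import Order.TTheory GRing.Theory Num.Theory.
Local Open Scope ring_scope.
Local Open Scope classical_set_scope.

(** * Work-span model *)

(* A computation DAG in topological order: its nodes are numbered from 0 and
   the k-th entry lists the predecessors of node k. *)
Definition dag := seq (seq nat).

Definition dag_edge (g : dag) (i j : nat) : bool := i \in nth [::] g j.

Definition dag_work (g : dag) : nat := size g.

(* Path lengths count vertices, i.e. operations. *)
Definition dag_span (g : dag) : nat :=
  \max_(k < (size g).+1 |
    [exists p : k.-tuple 'I_(size g),
       sorted (fun i j : 'I_(size g) => dag_edge g i j) p]) k.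

Inductive operation (A : Type) : Type :=
| OpAdd of A & A
| OpSub of A & A
| OpMul of A & A
| OpDiv of A & A
| OpLt of A & A
| OpSqrt of A
| OpExp of A.

Definition op_args A (o : operation A) : seq A :=
  match o with
  | OpAdd a b | OpSub a b | OpMul a b | OpDiv a b | OpLt a b => [:: a; b]
  | OpSqrt a | OpExp a => [:: a]
  end.

Definition op_value (R : realType) A (f : A -> R) (o : operation A) : R :=
  match o with
  | OpAdd a b => f a + f b
  | OpSub a b => f a - f b
  | OpMul a b => f a * f b
  | OpDiv a b => f a / f b
  | OpLt a b => if f a < f b then 1 else 0
  | OpSqrt a => Num.sqrt (f a)
  | OpExp a => expR (f a)
  end.

(* No computation may rely on the library's totalized division and root. *)
Definition op_defined (R : realType) A (f : A -> R) (o : operation A) : Prop :=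
  match o with
  | OpDiv a b => f b != 0
  | OpSqrt a => 0 <= f a
  | _ => True
  end.

(* V indexes the registers, X the input numbers. *)
Inductive operand (V X : Type) : Type :=
| Reg of V
| Inp of X
| Cst of nat.

Inductive cmd (V X : Type) : Type :=
| Skip
| Seq of cmd V X & cmd V X
| Assign of V & operation (operand V X)
| If of operand V X & operand V X & cmd V X & cmd V X
| While of operand V X & operand V X & cmd V X.
Arguments Skip {V X}.

(* [source v] is the node that produced the current content of register v,
   [control] the node of the last comparison that was branched on, and [trace]
   the DAG of the operations executed so far.  Overwriting a register creates
   no dependency: only the flow of values and of control does, so that [Seq]
   is not a source of sequentiality. *)
Record state (R : realType) (V : Type) : Type := State {
  content : V -> R;
  source : V -> option nat;
  control : option nat;
  trace : dag
}.

Definition init_state (R : realType) V : state R V :=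
  State (fun=> 0) (fun=> None) None [::].

Section Semantics.
Variables (R : realType) (V : eqType) (X : Type) (x : X -> R).

Definition operand_value (st : state R V) (a : operand V X) : R :=
  match a with
  | Reg v => content st v
  | Inp i => x i
  | Cst k => k%:R
  end.

Definition operand_source (st : state R V) (a : operand V X) : option nat :=
  if a is Reg v then source st v else None.

Definition predecessors (st : state R V) (s : seq (operand V X)) : seq nat :=
  pmap id (control st :: map (operand_source st) s).

Definition do_assign (st : state R V) (v : V) (o : operation (operand V X)) :
    state R V :=
  State (fun u => if u == v then op_value (operand_value st) o
                  else content st u)
        (fun u => if u == v then Some (size (trace st)) else source st u)
        (control st)
        (rcons (trace st) (predecessors st (op_args o))).

(* Branching costs one comparison, on which all later operations depend. *)
Definition do_branch (st : state R V) (a b : operand V X) : state R V :=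
  State (content st) (source st) (Some (size (trace st)))
        (rcons (trace st) (predecessors st [:: a; b])).

Definition test (st : state R V) (a b : operand V X) : bool :=
  operand_value st a < operand_value st b.

Inductive exec : cmd V X -> state R V -> state R V -> Prop :=
| ExecSkip st : exec Skip st st
| ExecSeq c1 c2 st st1 st2 :
    exec c1 st st1 -> exec c2 st1 st2 -> exec (Seq c1 c2) st st2
| ExecAssign v o st :
    op_defined (operand_value st) o -> exec (Assign v o) st (do_assign st v o)
| ExecIfTrue a b c1 c2 st st' :
    test st a b -> exec c1 (do_branch st a b) st' -> exec (If a b c1 c2) st st'
| ExecIfFalse a b c1 c2 st st' :
    ~~ test st a b -> exec c2 (do_branch st a b) st' ->
    exec (If a b c1 c2) st st'
| ExecWhileTrue a b c st st1 st2 :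
    test st a b -> exec c (do_branch st a b) st1 ->
    exec (While a b c) st1 st2 -> exec (While a b c) st st2
| ExecWhileFalse a b c st :
    ~~ test st a b -> exec (While a b c) st (do_branch st a b).

End Semantics.

(* Y indexes the output numbers. *)
Record program (X Y : Type) : Type := Program {
  register : finType;
  code : cmd register X;
  result : Y -> operand register X
}.

(* On input x, program a terminates with output y and computation DAG g. *)
Definition computes (R : realType) X Y (a : program X Y)
    (x : X -> R) (y : Y -> R) (g : dag) : Prop :=
  exists st : state R (register a),
    [/\ exec x (code a) (init_state R (register a)) st,
        forall k, y k = operand_value x st (result a k)
      & g = trace st].

(** * The problems (SVM) and (PD) *)

Definition enorm (R : realType) d (v : 'cV[R]_d) : R :=
  Num.sqrt (\sum_i v i 0 ^+ 2).

Definition entry_sum (R : realType) k (v : 'cV[R]_k) : R := \sum_i v i 0.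

Definition dotp (R : realType) d (v w : 'cV[R]_d) : R := \sum_i v i 0 * w i 0.

Record svm_point (R : realType) (d : nat) : Type := SvmPoint {
  dir : 'cV[R]_d;
  off1 : R;
  off2 : R
}.

Record pd_point (R : realType) (n1 n2 : nat) : Type := PdPoint {
  muw : 'cV[R]_n1;
  gamw : 'cV[R]_n2
}.

Section Problems.
Variables (R : realType) (d n1 n2 : nat).
Variables (P : 'M[R]_(d, n1)) (Q : 'M[R]_(d, n2)).
Implicit Types (z : svm_point R d) (p : pd_point R n1 n2).

Definition slackP z : 'cV[R]_n1 := P^T *m dir z - const_mx (off1 z).
Definition slackQ z : 'cV[R]_n2 := - (Q^T *m dir z) - const_mx (off2 z).

Definition svm_feasible z : Prop :=
  [/\ forall j, 0 <= slackP z j 0,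
      forall j, 0 <= slackQ z j 0
    & enorm (dir z) <= 1].

Definition svm_value z : R := off1 z + off2 z.

Definition pd_feasible p : Prop :=
  [/\ entry_sum (muw p) = 1, entry_sum (gamw p) = 1,
      forall j, 0 <= muw p j 0
    & forall j, 0 <= gamw p j 0].

Definition pd_value p : R := enorm (P *m muw p - Q *m gamw p).

Definition svm_optimum (OPT : R) : Prop :=
  let vals := [set svm_value z | z in [set z | svm_feasible z]] in
  vals OPT /\ ubound vals OPT.

Definition pd_optimum (OPT : R) : Prop :=
  let vals := [set pd_value p | p in [set p | pd_feasible p]] in
  vals OPT /\ lbound vals OPT.

Definition svm_approx (OPT eps : R) z : Prop :=
  svm_feasible z /\ (1 - eps) * OPT <= svm_value z.

Definition pd_approx (OPT eps : R) p : Prop :=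
  pd_feasible p /\ pd_value p <= (1 + eps) * OPT.

Definition max_norm : R :=
  Num.max (\big[Num.max/0]_(j < n1) enorm (col j P))
          (\big[Num.max/0]_(j < n2) enorm (col j Q)).

(** * The primal-dual meta-algorithm *)

Notation D := max_norm.

Definition oracle_feasible (alpha : R) z : Prop :=
  [/\ alpha <= off1 z + off2 z, enorm (dir z) <= 1, off1 z <= D & off2 z <= D].

Definition oracle_value p z : R :=
  dotp (P *m muw p - Q *m gamw p) (dir z)
  - entry_sum (muw p) * off1 z - entry_sum (gamw p) * off2 z.

Definition oracle_optimal (alpha : R) p z : Prop :=
  oracle_feasible alpha z /\
  forall z', oracle_feasible alpha z' -> oracle_value p z' <= oracle_value p z.

(* The average of x 1, ..., x t. *)
Definition average (x : nat -> svm_point R d) (t : nat) : svm_point R d :=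
  SvmPoint (t%:R^-1 *: \sum_(1 <= i < t.+1) dir (x i))
           (t%:R^-1 * \sum_(1 <= i < t.+1) off1 (x i))
           (t%:R^-1 * \sum_(1 <= i < t.+1) off2 (x i)).

Definition uniform_weights : pd_point R n1 n2 :=
  PdPoint (const_mx (n1 + n2)%:R^-1) (const_mx (n1 + n2)%:R^-1).

Definition exp_weights (rho eta : R) (x : nat -> svm_point R d) (t : nat) :
    pd_point R n1 n2 :=
  let f := fun u : R => expR (- (eta * t%:R / rho) * u) in
  let a := map_mx f (slackP (average x t)) in
  let b := map_mx f (slackQ (average x t)) in
  let C := entry_sum a + entry_sum b in
  PdPoint (C^-1 *: a) (C^-1 *: b).

(* The vector p^(t), t >= 1, when x 1, ..., x t.-1 are the oracle solutions of
   the previous iterations; t = 0 is not used. *)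
Definition weights (rho eta : R) (x : nat -> svm_point R d) (t : nat) :
    pd_point R n1 n2 :=
  if (t <= 1)%N then uniform_weights else exp_weights rho eta x t.-1.

Definition test_rho : R := 2 * D.

Definition test_T (alpha eps' : R) : nat :=
  `|Num.ceil (4 * 2 ^+ 2 * test_rho ^+ 2 * ln (n1 + n2)%:R
              / (eps' ^+ 2 * alpha ^+ 2))|%N.

Definition test_eta (alpha eps' : R) : R :=
  Num.sqrt (ln (n1 + n2)%:R / (test_T alpha eps')%:R).

Definition test_weights (alpha eps' : R) (x : nat -> svm_point R d) (t : nat) :
    pd_point R n1 n2 :=
  weights test_rho (test_eta alpha eps') x t.

(* x 1, ..., x m are oracle solutions of nonnegative value found in iterations
   1, ..., m of the feasibility test.  The oracle may return any optimal
   solution. *)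
Definition test_run (alpha eps' : R) (x : nat -> svm_point R d) (m : nat) :
    Prop :=
  forall t, (1 <= t <= m)%N ->
    oracle_optimal alpha (test_weights alpha eps' x t) (x t) /\
    0 <= oracle_value (test_weights alpha eps' x t) (x t).

Definition normalize p : pd_point R n1 n2 :=
  PdPoint ((entry_sum (muw p))^-1 *: muw p) ((entry_sum (gamw p))^-1 *: gamw p).

(* The test concludes that OPT < alpha and outputs p. *)
Definition test_below (alpha eps' : R) p : Prop :=
  exists (x : nat -> svm_point R d) (t : nat),
    [/\ (1 <= t <= test_T alpha eps')%N,
        test_run alpha eps' x t.-1,
        oracle_optimal alpha (test_weights alpha eps' x t) (x t),
        oracle_value (test_weights alpha eps' x t) (x t) < 0
      & p = normalize (test_weights alpha eps' x t)].

(* The test completes all its iterations and outputs z. *)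
Definition test_above (alpha eps' : R) z : Prop :=
  exists x : nat -> svm_point R d,
    test_run alpha eps' x (test_T alpha eps') /\
    let zbar := average x (test_T alpha eps') in
    z = SvmPoint (dir zbar) (off1 zbar - eps' * alpha / 2)
                            (off2 zbar - eps' * alpha / 2).

Definition middle_third (L U alpha eps' : R) : Prop :=
  (1 - eps') * alpha = L + (U - L) / 3 /\ alpha = U - (U - L) / 3.

(* [search L U z p]: the search can reach the interval [L, U] with z and p the
   last solutions found for (SVM) and (PD). *)
Inductive search : R -> R -> svm_point R d -> pd_point R n1 n2 -> Prop :=
| SearchInit p : pd_feasible p -> search 0 (2 * D) (SvmPoint 0 0 0) p
| SearchBelow L U z p alpha eps' p' :
    search L U z p -> middle_third L U alpha eps' ->
    test_below alpha eps' p' -> search L alpha z p'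
| SearchAbove L U z p alpha eps' z' :
    search L U z p -> middle_third L U alpha eps' ->
    test_above alpha eps' z' -> search ((1 - eps') * alpha) U z' p.

(* (z, p) is the output of a run of the meta-algorithm.  Since OPT is not known
   to the algorithm, it is not required to stop at the first interval of length
   at most eps * OPT, only at some such interval. *)
Definition meta_algorithm (OPT eps : R) z p : Prop :=
  exists L U, search L U z p /\ U - L <= eps * OPT.

End Problems.

(** * Inputs and outputs of a program for the problem *)

(* The logarithm is not an elementary operation; the number ln n, which depends
   on the size of the instance only, is provided along with the data. *)
Inductive svm_index (d n1 n2 : nat) : Type :=
| InP of 'I_d & 'I_n1
| InQ of 'I_d & 'I_n2
| InEps
| InLn.

Definition svm_input (R : realType) d n1 n2 (P : 'M[R]_(d, n1))
    (Q : 'M[R]_(d, n2)) (eps : R) (k : svm_index d n1 n2) : R :=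
  match k with
  | InP i j => P i j
  | InQ i j => Q i j
  | InEps => eps
  | InLn => ln (n1 + n2)%:R
  end.

Inductive sol_index (d n1 n2 : nat) : Type :=
| OutDir of 'I_d
| OutOff1
| OutOff2
| OutMu of 'I_n1
| OutGam of 'I_n2.
Arguments OutOff1 {d n1 n2}.
Arguments OutOff2 {d n1 n2}.
Arguments OutDir {d n1 n2}.
Arguments OutMu {d n1 n2}.
Arguments OutGam {d n1 n2}.

Definition svm_output (R : realType) d n1 n2 (y : sol_index d n1 n2 -> R) :
    svm_point R d :=
  SvmPoint (\col_i y (OutDir i)) (y OutOff1) (y OutOff2).

Definition pd_output (R : realType) d n1 n2 (y : sol_index d n1 n2 -> R) :
    pd_point R n1 n2 :=
  PdPoint (\col_j y (OutMu j)) (\col_j y (OutGam j)).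

(* Main.v *)
From HB Require Import structures.
Require Import Defs.
From mathcomp Require Import all_boot all_order all_algebra.
From mathcomp Require Import boolp classical_sets reals sequences exp.
From mathcomp Require Import zify ring lra.
Set Implicit Arguments.
Unset Strict Implicit.
Unset Printing Implicit Defensive.
Import Order.TTheory GRing.Theory Num.Theory.
Local Open Scope ring_scope.

(* The slacks of (w, s1, s2) are the transpose of the matrix with columns (u_j; 1; 0)
   and (-v_j; 0; 1) applied to (w; -s1; -s2), and the oracle maximizes the linear form
   whose coefficients are this matrix applied to the weights.  Both products consist of
   inner products, computed by balanced trees in O(nd) work and O(log(nd)) span.

   A test that completes its T iterations is a run of multiplicative weights, whose
   regret bound makes the average slacks at least -eps' alpha / 2.  If the normalized
   weights are at distance at least alpha, then the direction w that separates their
   two barycenters, with s1 and s2 its inner products with them, is feasible for the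
   oracle and has value 0; so a test that stops outputs a solution of (PD) below alpha.

   As OPT is unknown, the search stops when U - L <= eps L.  A round with gap U - L
   needs T = O(D^2 log n / (U - L)^2) iterations and multiplies the gap by 2/3, so the
   number of iterations is dominated by that of the last round, where U - L is of order
   eps OPT.

   Programs are composed of parallel layers of assignments; a layer increases the
   span of the computation by one and its work by the number of assignments. *)

(** The span is bounded without following paths: every node gets a level that increases along the
    edges, and the program logic carries an upper bound on the levels next to the number of
    operations. Commands are executed one after another, but a layer whose operations do not feed
    each other occupies a single level.

    Three quantities are not computed as the algorithm writes them. The weights stay unnormalized
    during a test, since a positive factor changes neither the maximizers of the oracle, nor the
    sign of its value, nor the normalized output. The tolerance enters only as the product eps'
    alpha, a third of the gap. There is no ceiling operation, so T is found by counting up to the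
    real number under the ceiling, at a cost that the T iterations absorb.

    The geometric sum over the rounds is never formed: D^2 ln n / gap^2 grows by the factor 9/4 > 2
    at each round, so that a fixed multiple of it dominates the number of all iterations so far plus
    one. The extra one pays for the initialization and for the last guard. *)

(** * Levels of a computation DAG *)

(* The first [n0] nodes precede the layer under execution, whose own nodes have
   level [s'] = [s] + 1. *)
Definition leveled (g : dag) (n0 s s' : nat) : Prop :=
  exists lev : nat -> nat,
    [/\ forall i j, dag_edge g i j -> (i < j)%N /\ (lev i < lev j)%N,
        forall k, (k < n0)%N -> (0 < lev k <= s)%N
      & forall k, (k < size g)%N -> (0 < lev k <= s')%N].

(** The new node gets level [s.+1], which exceeds the levels of its predecessors because these lie
    among the first [n0] nodes. Any number of such nodes raises the bound only once. *)
Lemma leveled_rcons (g : dag) l n0 s : (n0 <= size g)%N ->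
  {in l, forall i, (i < n0)%N} ->
  leveled g n0 s s.+1 -> leveled (rcons g l) n0 s s.+1.
Proof.
move=> le_n0 l_lt [lev [lev_edge lev_n0 lev_all]].
exists (fun k => if k == size g then s.+1 else lev k); split.
- move=> i j; rewrite /dag_edge nth_rcons.
  case: ltngtP => [j_lt|j_gt|->]; rewrite ?in_nil // => ij.
    have [i_lt lev_lt] := lev_edge _ _ ij.
    by rewrite (ltn_eqF (ltn_trans i_lt j_lt)).
  have i_lt := l_lt _ ij; have i_g := leq_trans i_lt le_n0.
  by rewrite (ltn_eqF i_g) i_g ltnS; have /andP[_ ->] := lev_n0 _ i_lt.
- move=> k k_lt; rewrite (ltn_eqF (leq_trans k_lt le_n0)); exact: lev_n0.
- move=> k; rewrite size_rcons ltnS leq_eqVlt.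
  by case: eqP => //= _ /lev_all.
Qed.

Lemma leveled_start g n0 s s' : leveled g n0 s s' -> leveled g (size g) s' s'.+1.
Proof.
move=> [lev [lev_edge _ lev_all]]; exists lev; split=> // k /lev_all /andP[-> /=].
exact: leqW.
Qed.

(** Levels strictly increase along a path, so its vertices have distinct levels between 1 and
    [s']. *)
Lemma span_leveled g n0 s s' : leveled g n0 s s' -> (dag_span g <= s')%N.
Proof.
move=> [lev [lev_edge _ lev_all]]; apply/bigmax_leqP => k /existsP[p p_path].
rewrite -(size_tuple p) -(size_map (fun i : 'I_(size g) => lev i)) -(size_iota 1 s').
apply: uniq_leq_size => [|_ /mapP[i _ ->]]; last first.
  by rewrite mem_iota add1n ltnS; apply: lev_all.
apply: (@sorted_uniq _ ltn); [exact: ltn_trans | exact: ltnn |].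
by rewrite sorted_map; apply: sub_sorted p_path => i j /lev_edge[].
Qed.

(** * A cost-aware calculus of weakest preconditions *)

Definition operand_regs (V X : Type) (a : operand V X) : seq V :=
  if a is Reg v then [:: v] else [::].

Definition reads (V X : Type) (o : operation (operand V X)) : seq V :=
  flatten (map (@operand_regs V X) (op_args o)).

Section Calculus.
Variables (R : realType) (V : eqType) (X : Type) (x : X -> R).
Implicit Types (st : state R V) (m : V -> R) (c : cmd V X) (w s : nat).
Implicit Types (a b : operand V X) (o : operation (operand V X)).
Implicit Types (Q : (V -> R) -> nat -> nat -> Prop).

Definition value m (a : operand V X) : R :=
  match a with Reg v => m v | Inp i => x i | Cst k => k%:R end.

Lemma eq_value m m' (a : operand V X) : {in operand_regs a, m =1 m'} ->
  value m a = value m' a.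
Proof. by case: a => //= v; apply; rewrite mem_head. Qed.

Lemma eq_op_value m m' o : {in reads o, m =1 m'} ->
  op_value (value m) o = op_value (value m') o.
Proof.
move=> mm'; have mm a : {subset operand_regs a <= reads o} -> value m a = value m' a.
  by move=> ao; apply: eq_value => v /ao /mm'.
by case: o mm' mm => [a b|a b|a b|a b|a b|a|a] /= _ mm; rewrite (mm a) ?(mm b) //;
  move=> v va; rewrite /reads /= !mem_cat va ?orbT.
Qed.

Lemma eq_op_defined m m' o : {in reads o, m =1 m'} ->
  op_defined (value m) o -> op_defined (value m') o.
Proof.
move=> mm'; have mm a : {subset operand_regs a <= reads o} -> value m a = value m' a.
  by move=> ao; apply: eq_value => v /ao /mm'.
by case: o mm' mm => [a b|a b|a b|a b|a b|a|a] //= _ mm;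
  rewrite 1?(mm b) 1?(mm a) // => v va; rewrite /reads /= !mem_cat va ?orbT.
Qed.

Definition sourced st (n0 : nat) : Prop :=
  (forall k, control st = Some k -> (k < n0)%N) /\
  (forall v k, source st v = Some k -> (k < n0)%N).

(* At most [w] operations so far, and no path longer than [s]. *)
Definition valid st w s : Prop :=
  [/\ (size (trace st) <= w)%N, sourced st (size (trace st))
    & leveled (trace st) (size (trace st)) s s].

(* The costs [w] and [s] are counted from the start of the program. *)
Definition wp c Q m w s : Prop :=
  forall st, content st = m -> valid st w s ->
  exists st' w' s', [/\ exec x c st st', valid st' w' s' & Q (content st') w' s'].

Lemma wp_skip Q m w s : Q m w s -> wp Skip Q m w s.
Proof.
by move=> Qm st stm val_st; exists st, w, s; split; rewrite ?stm //; exact: ExecSkip.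
Qed.

Lemma wp_seq c1 c2 Q m w s : wp c1 (wp c2 Q) m w s -> wp (Seq c1 c2) Q m w s.
Proof.
move=> c12 st stm val_st; have [st1 [w1 [s1 [e1 v1 c2Q]]]] := c12 st stm val_st.
have [st2 [w2 [s2 [e2 v2 Q2]]]] := c2Q st1 erefl v1.
by exists st2, w2, s2; split=> //; exact: ExecSeq e1 e2.
Qed.

Lemma predecessors_lt st n0 (l : seq (operand V X)) :
    (forall k, control st = Some k -> (k < n0)%N) ->
    (forall v k, v \in flatten (map (@operand_regs V X) l) ->
       source st v = Some k -> (k < n0)%N) ->
  {in predecessors st l, forall i, (i < n0)%N}.
Proof.
move=> ctl_lt src_lt i; rewrite mem_pmap map_id inE => /orP[/eqP/esym/ctl_lt //|].
elim: l src_lt => //= a l IHl src_lt.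
have ial : Some i \in [seq operand_source st b | b <- l] -> (i < n0)%N.
  by apply: IHl => v k vl; apply: src_lt; rewrite mem_cat vl orbT.
rewrite inE => /orP[/eqP/esym|//].
by case: a src_lt => //= v src_lt; apply: src_lt; exact: mem_head.
Qed.

Lemma valid_branch st a b w s : valid st w s -> valid (do_branch st a b) w.+1 s.+1.
Proof.
move=> [size_st [ctl src] lev]; have lev' := leveled_start lev; split.
- by rewrite size_rcons.
- split=> /= [k [<-]|v k /src k_lt]; rewrite size_rcons //; exact: leqW.
- suff: leveled (rcons (trace st) (predecessors st [:: a; b])) (size (trace st)) s s.+1.
    by case=> l [l1 l2 l3]; exists l; split.
  by apply: leveled_rcons => //; apply: predecessors_lt => // v k _; exact: src.
Qed.

Lemma wp_if a b c1 c2 Q m w s :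
  (value m a < value m b -> wp c1 Q m w.+1 s.+1) ->
  (value m b <= value m a -> wp c2 Q m w.+1 s.+1) ->
  wp (If a b c1 c2) Q m w s.
Proof.
move=> Q1 Q2 st stm val_st; have val_br := valid_branch a b val_st.
have [ab|ba] := ltP (value m a) (value m b).
  have [st' [w' [s' [e v q]]]] := Q1 ab (do_branch st a b) stm val_br.
  by exists st', w', s'; split=> //; apply: ExecIfTrue e; rewrite /test -stm in ab *.
have [st' [w' [s' [e v q]]]] := Q2 ba (do_branch st a b) stm val_br.
exists st', w', s'; split=> //; apply: ExecIfFalse e.
by rewrite /test -leNgt -stm in ba *.
Qed.

(** The number [k] is a decreasing variant, so the loop is proved to terminate. The invariant
    carries the costs, and each evaluation of the guard, the failing one included, adds one to
    both. *)
Lemma wp_while (I : nat -> (V -> R) -> nat -> nat -> Prop) a b c Q :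
    (forall k m w s, I k m w s -> value m a < value m b ->
       wp c (fun m' w' s' => exists2 k', (k' < k)%N & I k' m' w' s') m w.+1 s.+1) ->
    (forall k m w s, I k m w s -> value m b <= value m a -> Q m w.+1 s.+1) ->
  forall k m w s, I k m w s -> wp (While a b c) Q m w s.
Proof.
move=> step stop k; elim/ltn_ind: k => k IHk m w s Ik st stm val_st.
have val_br := valid_branch a b val_st.
have [ab|ba] := ltP (value m a) (value m b).
  have [st1 [w1 [s1 [e1 v1 [k1 k1_lt Ik1]]]]] :=
    step k m w s Ik ab (do_branch st a b) stm val_br.
  have [st2 [w2 [s2 [e2 v2 q2]]]] := IHk k1 k1_lt _ _ _ Ik1 _ erefl v1.
  exists st2, w2, s2; split=> //; apply: ExecWhileTrue e1 e2.
  by rewrite /test -stm in ab *.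
exists (do_branch st a b), w.+1, s.+1; split=> //.
  by apply: ExecWhileFalse; rewrite /test -leNgt -stm in ba *.
by rewrite /= stm; apply: stop Ik ba.
Qed.

Fixpoint layer (B : seq V) (f : V -> operation (operand V X)) : cmd V X :=
  if B is v :: B' then Seq (Assign v (f v)) (layer B' f) else Skip.

(* Since no operand of a layer is a register assigned earlier in the layer,
   its assignments behave as if they were simultaneous. *)
Lemma wp_layer B f Q m w s : uniq B ->
    (forall v, v \in B -> op_defined (value m) (f v)) ->
    (forall v u, v \in B -> u \in reads (f v) -> u \in B -> u = v) ->
    Q (fun v => if v \in B then op_value (value m) (f v) else m v)
      (w + size B)%N s.+1 ->
  wp (layer B f) Q m w s.
Proof.
move=> uniqB defB readB QB st stm [size_st [ctl src] lev].
pose n0 := size (trace st).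
have lev0 : leveled (trace st) n0 s s.+1 := leveled_start lev.
(* [B1] has been executed and [B2] remains. Registers outside [B1] still hold their value in [m] and
   were produced before the layer, which is what keeps all nodes of the layer on one level. *)
suff run B2 : forall B1 st1, B = B1 ++ B2 ->
    (forall v, content st1 v = if v \in B1 then op_value (value m) (f v) else m v) ->
    size (trace st1) = (n0 + size B1)%N ->
    (forall k, control st1 = Some k -> (k < n0)%N) ->
    (forall v k, source st1 v = Some k ->
       (k < if v \in B1 then size (trace st1) else n0)%N) ->
    leveled (trace st1) n0 s s.+1 ->
  exists st', [/\ exec x (layer B2 f) st1 st', valid st' (w + size B) s.+1
    & content st' = fun v => if v \in B then op_value (value m) (f v) else m v].
- have [||||||st' [e v cont]] := run B [::] st => //.
  - by rewrite stm.
  - by rewrite addn0.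
  by exists st', (w + size B)%N, s.+1; split; rewrite ?cont.
elim: B2 => [|v B2 IHB2] B1 st1 Bdef cont sz ctl1 src1 lev1.
- rewrite cats0 in Bdef; subst B1; exists st1; split; first exact: ExecSkip.
    split; first by rewrite sz leq_add2r.
      split=> [k /ctl1|u k /src1]; rewrite sz.
        by move=> /leq_trans; apply; exact: leq_addr.
      by case: ifP => // _ /leq_trans; apply; exact: leq_addr.
    by case: lev1 => l [l1 _ l3]; exists l; split.
  exact/funext.
have vB : v \in B by rewrite Bdef mem_cat mem_head orbT.
have vB1 : v \notin B1.
  by move: uniqB; rewrite Bdef cat_uniq /= => /and3P[_ /norP[]].
have readv u : u \in reads (f v) -> u \notin B1.
  move=> uf; apply: contra vB1 => uB1.
  by rewrite -(readB v u vB uf) // Bdef mem_cat uB1.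
have eqm : {in reads (f v), content st1 =1 m}.
  by move=> u /readv /negbTE uB1; rewrite cont uB1.
have [||||||st' [e val' cont']] := IHB2 (rcons B1 v) (do_assign x st1 v (f v)) => //=.
- by rewrite cat_rcons.
- move=> u; rewrite mem_rcons inE; case: eqP => [->|_] /=; last exact: cont.
  exact: (eq_op_value eqm).
- by rewrite !size_rcons sz addnS.
- move=> u k; rewrite mem_rcons inE; case: eqP => [_ [<-]|_ /src1]; rewrite size_rcons //=.
  by case: ifP => // _ /leqW.
- apply: leveled_rcons => //; first by rewrite sz leq_addr.
  apply: predecessors_lt => // u k /readv /negbTE uB1 /src1; by rewrite uB1.
exists st'; split=> //; apply: ExecSeq e; apply: ExecAssign.
apply: (@eq_op_defined m) (defB v vB) => u uf; exact/esym/eqm.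
Qed.

End Calculus.

(** * From an infinite to a finite type of registers *)

Definition map_operand (V V' X : Type) (h : V -> V') (a : operand V X) :
    operand V' X :=
  match a with Reg v => Reg X (h v) | Inp i => Inp V' i | Cst k => Cst V' X k end.

Definition map_operation (A A' : Type) (h : A -> A') (o : operation A) :
    operation A' :=
  match o with
  | OpAdd a b => OpAdd (h a) (h b)
  | OpSub a b => OpSub (h a) (h b)
  | OpMul a b => OpMul (h a) (h b)
  | OpDiv a b => OpDiv (h a) (h b)
  | OpLt a b => OpLt (h a) (h b)
  | OpSqrt a => OpSqrt (h a)
  | OpExp a => OpExp (h a)
  end.

Fixpoint map_cmd (V V' X : Type) (h : V -> V') (c : cmd V X) : cmd V' X :=
  match c with
  | Skip => Skip
  | Seq c1 c2 => Seq (map_cmd h c1) (map_cmd h c2)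
  | Assign v o => Assign (h v) (map_operation (map_operand h) o)
  | If a b c1 c2 =>
      If (map_operand h a) (map_operand h b) (map_cmd h c1) (map_cmd h c2)
  | While a b c => While (map_operand h a) (map_operand h b) (map_cmd h c)
  end.

Fixpoint cmd_regs (V X : Type) (c : cmd V X) : seq V :=
  match c with
  | Skip => [::]
  | Seq c1 c2 => cmd_regs c1 ++ cmd_regs c2
  | Assign v o => v :: reads o
  | If a b c1 c2 =>
      operand_regs a ++ operand_regs b ++ cmd_regs c1 ++ cmd_regs c2
  | While a b c => operand_regs a ++ operand_regs b ++ cmd_regs c
  end.

Section Renaming.
Variables (R : realType) (V V' : eqType) (X : Type) (x : X -> R).
Variables (h : V -> V') (B : seq V).
Hypothesis h_inj : {in B &, injective h}.

(** The traces are equal and not merely isomorphic: a DAG refers to operations by their position and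
    never to registers. *)
Definition simulates (st : state R V) (st' : state R V') : Prop :=
  [/\ {in B, forall v, content st' (h v) = content st v},
      {in B, forall v, source st' (h v) = source st v},
      control st' = control st & trace st' = trace st].

Lemma simulates_value st st' (a : operand V X) : simulates st st' ->
  {subset operand_regs a <= B} ->
  operand_value x st' (map_operand h a) = operand_value x st a.
Proof. by case=> cont _ _ _; case: a => //= v vB; rewrite cont // vB ?mem_head. Qed.

Lemma simulates_source st st' (a : operand V X) : simulates st st' ->
  {subset operand_regs a <= B} ->
  operand_source st' (map_operand h a) = operand_source st a.
Proof. by case=> _ src _ _; case: a => //= v vB; rewrite src // vB ?mem_head. Qed.

Lemma simulates_branch st st' (a b : operand V X) : simulates st st' ->
  {subset operand_regs a <= B} -> {subset operand_regs b <= B} ->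
  simulates (do_branch st a b)
    (do_branch st' (map_operand h a) (map_operand h b)).
Proof.
move=> sim aB bB; case: (sim) => cont src ctl tr; split=> //=; rewrite tr //.
by rewrite /predecessors /= ctl !(simulates_source sim).
Qed.

Lemma simulates_test st st' (a b : operand V X) : simulates st st' ->
  {subset operand_regs a <= B} -> {subset operand_regs b <= B} ->
  test x st' (map_operand h a) (map_operand h b) = test x st a b.
Proof. by move=> sim aB bB; rewrite /test !(simulates_value sim). Qed.

Lemma sub_op_args (o : operation (operand V X)) :
  {subset reads o <= B} ->
  match o with
  | OpAdd a b | OpSub a b | OpMul a b | OpDiv a b | OpLt a b =>
      {subset operand_regs a <= B} /\ {subset operand_regs b <= B}
  | OpSqrt a | OpExp a => {subset operand_regs a <= B}
  end.
Proof.
by case: o => [a b|a b|a b|a b|a b|a|a] /= oB; try split=> v va;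
  try move=> v va; apply: oB; rewrite ?cats0 ?mem_cat ?va ?orbT.
Qed.

Lemma exec_map c st1 st2 : exec x c st1 st2 ->
  {subset cmd_regs c <= B} -> forall st1', simulates st1 st1' ->
  exists2 st2', exec x (map_cmd h c) st1' st2' & simulates st2 st2'.
Proof.
have sub_catl (s t : seq V) : {subset s ++ t <= B} -> {subset s <= B}.
  by move=> st v vs; apply: st; rewrite mem_cat vs.
have sub_catr (s t : seq V) : {subset s ++ t <= B} -> {subset t <= B}.
  by move=> st v vs; apply: st; rewrite mem_cat vs orbT.
elim=> {c st1 st2} /=.
- by move=> st _ st' sim; exists st' => //; exact: ExecSkip.
- move=> c1 c2 st st1 st2 _ IH1 _ IH2 cB st' sim.
  have [st1' e1 sim1] := IH1 (sub_catl _ _ cB) _ sim.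
  have [st2' e2 sim2] := IH2 (sub_catr _ _ cB) _ sim1.
  by exists st2' => //; exact: ExecSeq e1 e2.
- move=> v o st def_o cB st' sim; case: (sim) => cont src ctl tr.
  have vB : v \in B by apply: cB; rewrite mem_head.
  have oB : {subset reads o <= B}.
    by move=> u uo; apply: cB; rewrite inE uo orbT.
  have args_o : predecessors st' (op_args (map_operation (map_operand h) o))
      = predecessors st (op_args o).
    by case: (o) (sub_op_args oB) => /= [a b|a b|a b|a b|a b|a|a] => [[]||||||];
      rewrite /predecessors /= ctl => *; rewrite !(simulates_source sim) //;
      match goal with H : _ /\ _ |- _ => case: H end.
  have val_o : op_value (operand_value x st') (map_operation (map_operand h) o)
      = op_value (operand_value x st) o.
    by case: (o) (sub_op_args oB) => /= [a b|a b|a b|a b|a b|a|a] => [[]||||||] *;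
      rewrite !(simulates_value sim) //;
      match goal with H : _ /\ _ |- _ => case: H end.
  exists (do_assign x st' (h v) (map_operation (map_operand h) o)).
    apply: ExecAssign; case: (o) (sub_op_args oB) def_o => //= [a b [_ bB]|a aB];
    by rewrite (simulates_value sim).
  split=> //=; last by rewrite tr args_o.
  - move=> u uB; rewrite val_o (inj_in_eq h_inj) //; case: eqP => // _; exact: cont.
  - move=> u uB; rewrite tr (inj_in_eq h_inj) //; case: eqP => // _; exact: src.
- move=> a b c1 c2 st st2 t _ IH cB st' sim.
  have aB := sub_catl _ _ cB; have bB := sub_catl _ _ (sub_catr _ _ cB).
  have [|st2' e2 sim2] := IH _ _ (simulates_branch sim aB bB).
    exact: sub_catl (sub_catr _ _ (sub_catr _ _ cB)).
  by exists st2' => //; apply: ExecIfTrue e2; rewrite (simulates_test sim).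
- move=> a b c1 c2 st st2 t _ IH cB st' sim.
  have aB := sub_catl _ _ cB; have bB := sub_catl _ _ (sub_catr _ _ cB).
  have [|st2' e2 sim2] := IH _ _ (simulates_branch sim aB bB).
    exact: sub_catr (sub_catr _ _ (sub_catr _ _ cB)).
  by exists st2' => //; apply: ExecIfFalse e2; rewrite (simulates_test sim).
- move=> a b c st st1 st2 t _ IH1 _ IH2 cB st' sim.
  have aB := sub_catl _ _ cB; have bB := sub_catl _ _ (sub_catr _ _ cB).
  have [|st1' e1 sim1] := IH1 _ _ (simulates_branch sim aB bB).
    exact: sub_catr (sub_catr _ _ cB).
  have [st2' e2 sim2] := IH2 cB _ sim1.
  by exists st2' => //; apply: ExecWhileTrue e1 e2; rewrite (simulates_test sim).
- move=> a b c st t cB st' sim.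
  have aB := sub_catl _ _ cB; have bB := sub_catl _ _ (sub_catr _ _ cB).
  exists (do_branch st' (map_operand h a) (map_operand h b)).
    by apply: ExecWhileFalse; rewrite (simulates_test sim).
  exact: simulates_branch.
Qed.

End Renaming.

(** The registers that occur in [c] or in [s] form a finite type, into which [insub] maps them
    injectively; all others collapse to [None]. The list [s] is there for the outputs, which [c] may
    not mention. *)
Definition finite_program (V : choiceType) (X Y : Type) (c : cmd V X)
    (s : seq V) (res : Y -> operand V X) : program X Y :=
  let h : V -> option (seq_sub (cmd_regs c ++ s)) := insub in
  Program (map_cmd h c) (fun k => map_operand h (res k)).

Lemma computes_wp (R : realType) (V : choiceType) (X Y : Type) (x : X -> R)
    (c : cmd V X) (s : seq V) (res : Y -> operand V X)
    (Q : (V -> R) -> nat -> nat -> Prop) :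
  (forall k, {subset operand_regs (res k) <= s}) ->
  wp x c Q (fun=> 0) 0 0 ->
  exists m g, [/\ computes (finite_program c s res) x (fun k => value x m (res k)) g
    & exists w k, [/\ Q m w k, (dag_work g <= w)%N & (dag_span g <= k)%N]].
Proof.
move=> res_s wp_c.
have [|st [w [k [e v q]]]] := wp_c (init_state R V) erefl.
  split=> //; exists (fun=> 0%N); split=> // i j; by rewrite /dag_edge nth_nil.
have h_inj : {in cmd_regs c ++ s &,
    injective (insub : V -> option (seq_sub (cmd_regs c ++ s)))}.
  move=> a b aB bB; rewrite (insubT (fun v => v \in _) aB) (insubT (fun v => v \in _) bB).
  by case.
have cB : {subset cmd_regs c <= cmd_regs c ++ s} by move=> u uc; rewrite mem_cat uc.
have sim0 : simulates insub (cmd_regs c ++ s) (init_state R V)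
   (init_state R (option (seq_sub (cmd_regs c ++ s)))) by split.
have [st' e' sim] := exec_map h_inj e cB sim0.
exists (content st), (trace st); split.
  exists st'; split=> //=; last by case: sim.
  move=> y; rewrite (simulates_value x sim) // => u /res_s us.
  by rewrite mem_cat us orbT.
exists w, k; split=> //; first by case: v.
by case: v => _ _ /span_leveled.
Qed.

(** * Multiplicative weights *)

Section MultiplicativeWeights.
Variable R : realType.

(** From exp(- u/2) >= 1 - u/2 one gets exp(u) <= (1 - u/2)^(-2), and (1 - u/2)^2 (1 + u + u^2) = 1
    + u^2/4 (1 - 3 u + u^2) is at least 1 as soon as u <= 1/3. *)
Lemma expR_quadratic (u : R) : `|u| <= 1 / 3 -> expR u <= 1 + u + u ^+ 2.
Proof.
rewrite ler_norml => /andP[u_ge u_le].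
have half_le : (1 - u / 2) * expR (u / 2) <= 1.
  rewrite -ler_pdivlMr ?expR_gt0 // div1r -expRN.
  exact: expR_ge1Dx.
have y_gt0 := expR_gt0 (u / 2); set y := expR (u / 2) in half_le y_gt0.
have -> : expR u = y ^+ 2 by rewrite /y -expRM_natl; congr expR; lra.
have v_gt0 : 0 < 1 - u / 2 by lra.
have y2_le : ((1 - u / 2) * y) ^+ 2 <= 1 by rewrite expr_le1 //; nra.
have : 1 <= (1 - u / 2) ^+ 2 * (1 + u + u ^+ 2).
  have -> : (1 - u / 2) ^+ 2 * (1 + u + u ^+ 2)
    = 1 + u ^+ 2 / 4 * (1 - 3 * u + u ^+ 2) by field.
  by rewrite lerDl mulr_ge0 ?divr_ge0 ?sqr_ge0 //; nra.
move=> /(le_trans y2_le); rewrite exprMn ler_pM2l //; exact: exprn_gt0.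
Qed.

(** The exponential potential [phi] starts at [#|I|] and grows at each step by a factor of at most 1
    + eta^2 <= exp(eta^2). Each of its terms is bounded by the whole, and taking logarithms gives
    the bound. *)
Lemma mwu_regret (I : finType) (l : nat -> I -> R) (rho eta : R) (T : nat) :
    0 < rho -> 0 < eta <= 1 / 3 ->
    (forall t j, (1 <= t <= T)%N -> `|l t j| <= rho) ->
    (forall t, (1 <= t <= T)%N ->
       0 <= \sum_j expR (- (eta / rho) * \sum_(1 <= i < t) l i j) * l t j) ->
  forall j, - rho * (ln #|I|%:R / eta + eta * T%:R) <= \sum_(1 <= i < T.+1) l i j.
Proof.
move=> rho_gt0 /andP[eta_gt0 eta_le] l_le l_sum j.
pose phi t := \sum_j expR (- (eta / rho) * \sum_(1 <= i < t.+1) l i j).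
have I_gt0 : 0 < #|I|%:R :> R by rewrite ltr0n; apply/card_gt0P; exists j.
have phi_le t : (t <= T)%N -> phi t <= #|I|%:R * expR (eta ^+ 2 * t%:R).
  elim: t => [_|t IHt t_lt].
    rewrite mulr0 expR0 mulr1 -sum1_card natr_sum; apply: ler_sum => i _.
    by rewrite big_geq // mulr0 expR0.
  (* After the quadratic bound on the exponential, the linear term sums to - eta / rho times the
     weighted loss, which is nonpositive by assumption. *)
  have /le_trans -> // : phi t.+1 <= (1 + eta ^+ 2) * phi t.
    have tT : (1 <= t.+1 <= T)%N by [].
    have := l_sum _ tT; rewrite -subr_ge0 => sum_ge0.
    have k_gt0 : 0 < eta / rho by exact: divr_gt0.
    have -> : (1 + eta ^+ 2) * phi t = \sum_j (1 + eta ^+ 2)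
        * expR (- (eta / rho) * \sum_(1 <= i < t.+1) l i j) by rewrite mulr_sumr.
    rewrite -subr_ge0 -sumrB.
    apply: (le_trans (mulr_ge0 (ltW k_gt0) (l_sum _ tT))).
    rewrite mulr_sumr; apply: ler_sum => i _; rewrite [in X in _ <= _ - X]big_nat_recr //=.
    set S := \sum_(1 <= _ < _) _; rewrite mulrDr expRD.
    set E := expR (_ * S); have E_gt0 : 0 < E by exact: expR_gt0.
    have := l_le _ i tT; set L := l _ _ => L_le.
    have kL_le : `|- (eta / rho) * L| <= eta.
      rewrite normrM normrN (gtr0_norm k_gt0) mulrAC ler_pdivrMr //.
      by rewrite ler_pM2l.
    have := expR_quadratic (le_trans kL_le eta_le).
    have kL2_le : (- (eta / rho) * L) ^+ 2 <= eta ^+ 2.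
      by rewrite -real_normK ?num_real // lerXn2r ?nnegrE // ltW.
    set K := eta / rho in kL2_le *; set e := expR _ => e_le.
    have : E * e <= E * (1 + - K * L + eta ^+ 2) by rewrite ler_pM2l //; lra.
    by lra.
  rewrite mulrS mulrDr mulr1 expRD mulrCA.
  apply: ler_pM; rewrite ?IHt // 1?ltnW //.
  - by rewrite addr_ge0 // sqr_ge0.
  - by apply: sumr_ge0 => i _; exact: expR_ge0.
  - exact: expR_ge1Dx.
have := phi_le T (leqnn T); set S := \sum_(1 <= _ < _) _.
have : expR (- (eta / rho) * S) <= phi T.
  by rewrite /phi (bigD1 j) //= lerDl; apply: sumr_ge0 => i _; exact: expR_ge0.
move=> /le_trans /[apply]; rewrite -{1}(lnK I_gt0) -expRD ler_expR.
have -> : - (eta / rho) * S = - (S / rho) * eta by field; rewrite ?gt_eqF.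
rewrite -ler_pdivlMr // lerNl ler_pdivlMr // => S_ge; apply: le_trans S_ge.
by rewrite le_eqVlt; apply/orP; left; apply/eqP; field; rewrite gt_eqF.
Qed.

End MultiplicativeWeights.

(** * Correctness of the feasibility test *)

Section Correctness.
Variable R : realType.

Lemma enorm_ge0 d (v : 'cV[R]_d) : 0 <= enorm v.
Proof. exact: sqrtr_ge0. Qed.

Lemma enorm_sqr d (v : 'cV[R]_d) : enorm v ^+ 2 = dotp v v.
Proof. by rewrite sqr_sqrtr // sumr_ge0 // => i _; exact: sqr_ge0. Qed.

Lemma dotpC d (v w : 'cV[R]_d) : dotp v w = dotp w v.
Proof. by apply: eq_bigr => i _; rewrite mulrC. Qed.

Lemma dotpBl d (u v w : 'cV[R]_d) : dotp (u - v) w = dotp u w - dotp v w.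
Proof. by rewrite -sumrB; apply: eq_bigr => i _; rewrite !mxE mulrBl. Qed.

Lemma dotpZl d a (v w : 'cV[R]_d) : dotp (a *: v) w = a * dotp v w.
Proof. by rewrite mulr_sumr; apply: eq_bigr => i _; rewrite !mxE mulrA. Qed.

Lemma dotpZr d a (v w : 'cV[R]_d) : dotp v (a *: w) = a * dotp v w.
Proof. by rewrite dotpC dotpZl dotpC. Qed.

Lemma dotp_suml d (I : Type) (r : seq I) (F : I -> 'cV[R]_d) w :
  dotp (\sum_(i <- r) F i) w = \sum_(i <- r) dotp (F i) w.
Proof.
rewrite exchange_big; apply: eq_bigr => i _.
by rewrite summxE mulr_suml.
Qed.

Lemma enormZ d a (v : 'cV[R]_d) : enorm (a *: v) = `|a| * enorm v.
Proof.
rewrite -[RHS]ger0_norm ?mulr_ge0 ?enorm_ge0 // -sqrtr_sqr exprMn enorm_sqr.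
congr Num.sqrt; rewrite real_normK ?num_real // mulr_sumr.
by apply: eq_bigr => i _; rewrite mxE exprMn.
Qed.

Lemma dotp0r d (v : 'cV[R]_d) : dotp v 0 = 0.
Proof. by rewrite /dotp big1 // => i _; rewrite mxE mulr0. Qed.

Lemma enorm0 d : enorm (0 : 'cV[R]_d) = 0.
Proof. by rewrite /enorm big1 ?sqrtr0 // => i _; rewrite mxE expr0n. Qed.

Lemma enorm_eq0 d (v : 'cV[R]_d) : enorm v = 0 -> v = 0.
Proof.
move=> v0; have : enorm v ^+ 2 = 0 by rewrite v0 expr0n.
rewrite enorm_sqr => /eqP; rewrite psumr_eq0 => [/allP vi0|i _]; last first.
  by rewrite -expr2 sqr_ge0.
apply/colP => i; rewrite mxE; apply/eqP.
by have := vi0 i; rewrite mem_index_enum mulf_eq0 orbb; apply.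
Qed.

(** Cauchy-Schwarz, from the square of |w| v - |v| w. *)
Lemma dotp_le d (v w : 'cV[R]_d) : dotp v w <= enorm v * enorm w.
Proof.
have := enorm_ge0 v; rewrite le_eqVlt => /predU1P[/esym v0|v_gt0].
  by rewrite v0 mul0r (enorm_eq0 v0) dotpC dotp0r.
have := enorm_ge0 w; rewrite le_eqVlt => /predU1P[/esym w0|w_gt0].
  by rewrite w0 mulr0 (enorm_eq0 w0) dotp0r.
have : 0 <= dotp (enorm w *: v - enorm v *: w) (enorm w *: v - enorm v *: w).
  by rewrite -enorm_sqr sqr_ge0.
rewrite dotpBl !(dotpC _ (_ - _)) !dotpBl !dotpZl !dotpZr -!enorm_sqr (dotpC w v).
have vw_gt0 := mulr_gt0 v_gt0 w_gt0; set a := enorm v in v_gt0 vw_gt0 *.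
set b := enorm w in w_gt0 vw_gt0 *; set c := dotp v w.
have -> : b * (b * a ^+ 2) - a * (b * c) - (b * (a * c) - a * (a * b ^+ 2))
  = 2 * (a * b) * (a * b - c) by ring.
by rewrite pmulr_rge0 ?subr_ge0 // mulr_gt0.
Qed.

Lemma norm_dotp_le d (v w : 'cV[R]_d) : `|dotp v w| <= enorm v * enorm w.
Proof.
rewrite ler_norml dotp_le andbT lerNl.
have -> : - dotp v w = dotp (-1 *: v) w by rewrite dotpZl mulN1r.
by rewrite (le_trans (dotp_le _ _)) // enormZ normrN normr1 mul1r.
Qed.

Variables (d n1 n2 : nat) (P : 'M[R]_(d, n1)) (Q : 'M[R]_(d, n2)).
Implicit Types (z : svm_point R d) (p : pd_point R n1 n2).
Implicit Types (x : nat -> svm_point R d).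

Let D := max_norm P Q.

(** Both blocks of constraints are stacked, so that the entries are the losses of [n1 + n2]
    experts. *)
Definition slack z : 'cV[R]_(n1 + n2) := col_mx (slackP P z) (slackQ Q z).

Definition wvec p : 'cV[R]_(n1 + n2) := col_mx (muw p) (gamw p).

Lemma max_norm_ge0 : 0 <= D.
Proof. by rewrite /D /max_norm le_max bigmax_ge_id. Qed.

Lemma enorm_colP j : enorm (col j P) <= D.
Proof. by rewrite /D /max_norm le_max (le_bigmax _ (fun j => enorm (col j P))). Qed.

Lemma enorm_colQ j : enorm (col j Q) <= D.
Proof. by rewrite /D /max_norm le_max (le_bigmax _ (fun j => enorm (col j Q))) orbT. Qed.

Lemma dotp_mulmx k (A : 'M[R]_(d, k)) (v : 'cV[R]_k) (w : 'cV[R]_d) :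
  dotp (A *m v) w = \sum_j v j 0 * dotp (col j A) w.
Proof.
rewrite {1}/dotp; under eq_bigr do rewrite mxE mulr_suml.
rewrite exchange_big; apply: eq_bigr => j _; rewrite mulr_sumr.
by apply: eq_bigr => i _; rewrite !mxE mulrAC mulrC.
Qed.

Lemma slackPE z j : slackP P z j 0 = dotp (col j P) (dir z) - off1 z.
Proof. by rewrite !mxE; congr (_ - _); apply: eq_bigr => i _; rewrite !mxE. Qed.

Lemma slackQE z j : slackQ Q z j 0 = - dotp (col j Q) (dir z) - off2 z.
Proof. by rewrite !mxE; congr (- _ - _); apply: eq_bigr => i _; rewrite !mxE. Qed.

(** The value of the oracle is the weighted loss of the experts; its nonnegativity is the hypothesis
    of the regret bound. *)
Lemma oracle_valueE p z :
  oracle_value P Q p z = \sum_j wvec p j 0 * slack z j 0.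
Proof.
rewrite big_split_ord /=.
under eq_bigr do rewrite !col_mxEu slackPE mulrBr.
under [X in _ = _ + X]eq_bigr do rewrite !col_mxEd slackQE mulrBr mulrN.
rewrite !sumrB sumrN -!mulr_suml -!dotp_mulmx /oracle_value dotpBl.
by rewrite /entry_sum; ring.
Qed.

(** The bounds s1, s2 <= D and s1 + s2 >= alpha > 0 put both offsets in [- D, D]. This is the origin
    of the width rho = 2 D. *)
Lemma slack_le alpha z j : 0 < alpha -> oracle_feasible P Q alpha z ->
  `|slack z j 0| <= 2 * D.
Proof.
move=> alpha_gt0 [sum_ge dir_le off1_le off2_le].
have dot_le v : enorm v <= D -> `|dotp v (dir z)| <= D.
  move=> v_le; apply: (le_trans (norm_dotp_le _ _)).
  by rewrite -[leRHS]mulr1 ler_pM ?enorm_ge0.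
rewrite -/D in off1_le off2_le.
rewrite -[j]splitK; case: (split j) => k /=.
  have := dot_le _ (enorm_colP k); rewrite col_mxEu slackPE !ler_norml => /andP[].
  by move=> *; apply/andP; split; lra.
have := dot_le _ (enorm_colQ k); rewrite col_mxEd slackQE !ler_norml => /andP[].
by move=> *; apply/andP; split; lra.
Qed.

Lemma pd_dotp_le p (w : 'cV[R]_d) : pd_feasible p ->
  dotp (P *m muw p) w <= D * enorm w /\ - dotp (Q *m gamw p) w <= D * enorm w.
Proof.
move=> [mu1 gam1 mu_ge0 gam_ge0]; split.
  rewrite -[leRHS]mul1r -mu1 dotp_mulmx mulr_suml; apply: ler_sum => j _.
  apply: ler_wpM2l; first exact: mu_ge0.
  apply: (le_trans (dotp_le _ _)); apply: ler_wpM2r; first exact: enorm_ge0.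
  exact: enorm_colP.
rewrite -[leRHS]mul1r -gam1 dotp_mulmx mulr_suml -sumrN; apply: ler_sum => j _.
rewrite -mulrN; apply: ler_wpM2l; first exact: gam_ge0.
apply: (le_trans (ler_norm _)); rewrite normrN; apply: (le_trans (norm_dotp_le _ _)).
apply: ler_wpM2r; first exact: enorm_ge0.
exact: enorm_colQ.
Qed.

(** Puts the optimum in the initial interval [0, 2 D]. With h the difference of the barycenters,
    |h|^2 is its inner product with itself, hence at most 2 D |h|. *)
Lemma pd_value_le p : pd_feasible p -> pd_value P Q p <= 2 * D.
Proof.
move=> p_feas; rewrite /pd_value; set h := P *m _ - _.
have [h_le h_le'] := pd_dotp_le h p_feas.
have : enorm h ^+ 2 <= 2 * D * enorm h.
  by rewrite enorm_sqr {1}/h dotpBl; lra.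
have := enorm_ge0 h; rewrite le_eqVlt => /predU1P[<- _|h_gt0].
  by rewrite mulr_ge0 ?max_norm_ge0.
by rewrite expr2 ler_pM2r.
Qed.

Lemma below_pd (alpha : R) p z :
    0 < alpha -> 0 < entry_sum (muw p) -> 0 < entry_sum (gamw p) ->
    (forall j, 0 <= muw p j 0) -> (forall j, 0 <= gamw p j 0) ->
    oracle_optimal P Q alpha p z -> oracle_value P Q p z < 0 ->
  pd_feasible (normalize p) /\ pd_value P Q (normalize p) < alpha.
Proof.
move=> alpha_gt0; set a := entry_sum _; set b := entry_sum _ => a_gt0 b_gt0 mu_ge0 gam_ge0.
move=> [_ z_opt] z_lt0.
have norm_feas : pd_feasible (normalize p).
  split=> [||j|j]; rewrite ?mxE ?mulr_ge0 ?invr_ge0 ?mu_ge0 ?gam_ge0 ?ltW //;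
  rewrite /entry_sum; under eq_bigr do rewrite mxE;
  by rewrite -mulr_sumr mulVf // gt_eqF.
split=> //; rewrite ltNge; apply/negP; rewrite /pd_value; set h := _ - _ => h_ge.
have h_gt0 := lt_le_trans alpha_gt0 h_ge.
pose w := (enorm h)^-1 *: h.
have w1 : enorm w = 1 by rewrite enormZ gtr0_norm ?invr_gt0 // mulVf // gt_eqF.
have hw : dotp h w = enorm h.
  by rewrite dotpZr -enorm_sqr expr2 mulrA mulVf ?mul1r // gt_eqF.
have [s1_le s2_le] := pd_dotp_le w norm_feas; rewrite w1 !mulr1 in s1_le s2_le.
set s1 := dotp _ w in s1_le; set s2 := - dotp _ w in s2_le.
have /z_opt : oracle_feasible P Q alpha (SvmPoint w s1 s2).
  split=> //=; last by rewrite w1.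
  by move: hw; rewrite /h dotpBl -/s1 -/s2 => ->.
rewrite leNgt => /negP; apply; apply: (lt_le_trans z_lt0).
rewrite /oracle_value /= /s1 /s2 -!scalemxAr !dotpZl dotpBl -/a -/b.
have -> : forall u v : R, u - v - a * (a^-1 * u) - b * - (b^-1 * v) = 0 => //.
by move=> u v; field; rewrite ?gt_eqF // gt_eqF.
Qed.

Lemma slack_average x t j : (0 < t)%N ->
  slack (average x t) j 0 = t%:R^-1 * \sum_(1 <= i < t.+1) slack (x i) j 0.
Proof.
move=> t_gt0; have t_neq0 : t%:R != 0 :> R by rewrite pnatr_eq0 -lt0n.
have dir_avg (v : 'cV[R]_d) : dotp v (dir (average x t))
    = t%:R^-1 * \sum_(1 <= i < t.+1) dotp v (dir (x i)).
  rewrite dotpZr dotpC dotp_suml; congr (_ * _).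
  by apply: eq_bigr => i _; rewrite dotpC.
rewrite -[j]splitK; case: (split j) => k /=.
  under eq_bigr do rewrite col_mxEu slackPE.
  by rewrite col_mxEu slackPE sumrB mulrBr dir_avg.
under eq_bigr do rewrite col_mxEd slackQE.
by rewrite col_mxEd slackQE sumrB sumrN mulrBr mulrN dir_avg.
Qed.

(** The uniform start is the case of an empty sum, so no iteration is special: the factor [c]
    absorbs the normalization, and eta t / rho times an average is eta / rho times a sum. *)
Lemma weights_exp rho eta x t : (0 < n1)%N -> exists2 c : R, 0 < c &
  forall j, wvec (weights P Q rho eta x t.+1) j 0
    = c * expR (- (eta / rho) * \sum_(1 <= i < t.+1) slack (x i) j 0).
Proof.
move=> n1_gt0; case: t => [|t].
  exists (n1 + n2)%:R^-1; first by rewrite invr_gt0 ltr0n addn_gt0 n1_gt0.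
  move=> j; rewrite big_geq // mulr0 expR0 mulr1.
  by rewrite -[j]splitK; case: (split j) => k /=; rewrite ?col_mxEu ?col_mxEd mxE.
rewrite /weights /= /exp_weights; set a := map_mx _ _; set b := map_mx _ _.
set c := entry_sum a + entry_sum b; exists c^-1.
  rewrite invr_gt0 /c /entry_sum (bigD1 (Ordinal n1_gt0)) //= -addrA.
  rewrite ltr_wpDr ?addr_ge0 ?sumr_ge0 // => [i _|i _|]; rewrite mxE ?expR_ge0 //.
  exact: expR_gt0.
move=> j; have -> : - (eta / rho) * \sum_(1 <= i < t.+2) slack (x i) j 0
    = - (eta * t.+1%:R / rho) * slack (average x t.+1) j 0.
  rewrite slack_average //; set S := \sum_(_ <= _ < _) _.
  have t_neq0 : t.+1%:R != 0 :> R by rewrite pnatr_eq0.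
  by set r := rho^-1; field; rewrite addrC natr1.
rewrite -[j]splitK; case: (split j) => k /=;
  by rewrite ?col_mxEu ?col_mxEd 2!mxE ?col_mxEu ?col_mxEd.
Qed.

Section Test.
Variables alpha eps' : R.
Hypotheses (n1_gt0 : (0 < n1)%N) (n2_gt0 : (0 < n2)%N) (D_gt0 : 0 < D).
Hypotheses (alpha_gt0 : 0 < alpha).
Hypotheses (tol_gt0 : 0 < eps' * alpha) (tol_le : eps' * alpha <= 2 * D / 3).

Let T := test_T P Q alpha eps'.
Let eta := test_eta P Q alpha eps'.

Lemma ln_size_gt0 : 0 < ln (n1 + n2)%:R :> R.
Proof. by rewrite ln_gt0 // ltr1n -(addn1 1) leq_add. Qed.

(** The constant 64 is 4 * 2^2 * 2^2, from R = 2 and rho = 2 D. *)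
Lemma test_T_ge :
  64 * D ^+ 2 * ln (n1 + n2)%:R / (eps' * alpha) ^+ 2 <= T%:R.
Proof.
have -> : 64 * D ^+ 2 * ln (n1 + n2)%:R / (eps' * alpha) ^+ 2
   = 4 * 2 ^+ 2 * test_rho P Q ^+ 2 * ln (n1 + n2)%:R / (eps' ^+ 2 * alpha ^+ 2).
  by rewrite /test_rho -/D exprMn; congr (_ / _); ring.
rewrite /T /test_T; set y := _ / _.
by rewrite natr_absz; apply: (le_trans (ceil_ge y)); rewrite ler_int; exact: ler_norm.
Qed.

Lemma test_T_gt0 : (0 < T)%N.
Proof.
rewrite -(ltr0n R); apply: lt_le_trans test_T_ge.
by rewrite divr_gt0 ?exprn_gt0 // !mulr_gt0 ?exprn_gt0 ?ln_size_gt0.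
Qed.

Lemma test_eta_gt0 : 0 < eta.
Proof. by rewrite sqrtr_gt0 divr_gt0 ?ln_size_gt0 // ltr0n test_T_gt0. Qed.

Lemma test_eta_sqr : eta ^+ 2 * T%:R = ln (n1 + n2)%:R.
Proof.
rewrite sqr_sqrtr; last by rewrite divr_ge0 // ltW // ln_size_gt0.
by rewrite divfK // pnatr_eq0 -lt0n test_T_gt0.
Qed.

(** The average regret of a test is 2 rho eta = 4 D eta, hence at most eps' alpha / 2. Together with
    [tol_le] the bound also gives eta <= 1/12, within the range of [mwu_regret]. *)
Lemma test_eta_le : 8 * D * eta <= eps' * alpha.
Proof.
have T_gt0 : 0 < T%:R :> R by rewrite ltr0n test_T_gt0.
have lhs_ge0 : 0 <= 8 * D * eta by rewrite !mulr_ge0 ?(ltW D_gt0) ?(ltW test_eta_gt0).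
rewrite -ler_sqr ?nnegrE ?(ltW tol_gt0) //.
rewrite -(ler_pM2r T_gt0) exprMn -[leLHS]mulrA test_eta_sqr exprMn.
have := test_T_ge; rewrite ler_pdivrMr ?exprn_gt0 // => T_ge.
by rewrite mulrC in T_ge; lra.
Qed.

Lemma weights_gt0 x t j : 0 < wvec (test_weights P Q alpha eps' x t.+1) j 0.
Proof.
have [c c_gt0 ->] := weights_exp (test_rho P Q) eta x t n1_gt0.
by rewrite mulr_gt0 // expR_gt0.
Qed.

Lemma test_above_svm z : test_above P Q alpha eps' z ->
  svm_feasible P Q z /\ (1 - eps') * alpha <= svm_value z.
Proof.
move=> [x [run zE]]; pose zbar := average x T.
have {zE}-> : z = SvmPoint (dir zbar) (off1 zbar - eps' * alpha / 2)
                           (off2 zbar - eps' * alpha / 2) by [].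
have T_gt0 := test_T_gt0; have Tr_gt0 : 0 < T%:R :> R by rewrite ltr0n.
have eta_gt0 := test_eta_gt0; have eta_le := test_eta_le.
have feas t : (1 <= t <= T)%N -> oracle_feasible P Q alpha (x t).
  by move=> /run[[]].
have slack_ge j : - (eps' * alpha / 2) <= slack zbar j 0.
  rewrite slack_average // ler_pdivlMl //.
  have rho_gt0 : 0 < test_rho P Q by rewrite mulr_gt0.
  have eta_le3 : 0 < eta <= 1 / 3.
    rewrite eta_gt0 /= -(ler_pM2l D_gt0); move: D_gt0 tol_le eta_le.
    by move: (D) (eta) (eps' * alpha) => u v y *; lra.
  have := @mwu_regret R _ (fun t j => slack (x t) j 0) _ _ T rho_gt0 eta_le3 _ _ j.
  rewrite card_ord => regret; apply: le_trans (regret _ _).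
  (* The choice of [eta] balances the two terms of the regret. *)
  - have -> : ln (n1 + n2)%:R / eta = eta * T%:R.
      rewrite -test_eta_sqr; move: eta_gt0; move: (eta) (T%:R : R) => u v u_gt0.
      by field; rewrite gt_eqF.
    rewrite /test_rho -/D.
    have -> : - (2 * D) * (eta * T%:R + eta * T%:R) = T%:R * - (4 * D * eta) by ring.
    rewrite ler_pM2l // lerN2; move: eta_le.
    by move: (D) (eta) (eps' * alpha) => u v y; lra.
  - by move=> t i /feas; exact: slack_le.
  - case=> // t /run[_]; rewrite oracle_valueE.
    have [c c_gt0 wE] := weights_exp (test_rho P Q) eta x t n1_gt0.
    under eq_bigr do rewrite wE -mulrA.
    by rewrite -mulr_sumr pmulr_rge0.
have sum_le (F : nat -> R) c : (forall t, (1 <= t <= T)%N -> c <= F t) ->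
    c <= T%:R^-1 * \sum_(1 <= i < T.+1) F i.
  move=> c_le; rewrite ler_pdivlMl //.
  have -> : T%:R * c = \sum_(1 <= i < T.+1) c.
    by rewrite sumr_const_nat subSS subn0 mulr_natl.
  by rewrite !big_nat; apply: ler_sum => t; rewrite ltnS; exact: c_le.
split; last first.
  have : alpha <= off1 zbar + off2 zbar.
    rewrite /= -mulrDr -big_split /=; apply: sum_le => t /feas[]; lra.
  by rewrite /svm_value /=; lra.
split=> [j|j|] /=.
- have := slack_ge (lshift _ j); rewrite col_mxEu !slackPE /=; lra.
- have := slack_ge (rshift _ j); rewrite col_mxEd !slackQE /=; lra.
(* The ball is convex: the squared norm of the average direction is the average of its inner
   products with the directions of the [x t], each at most its norm. *)
rewrite -/(dir zbar); have := enorm_ge0 (dir zbar).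
rewrite le_eqVlt => /predU1P[<- //|dir_gt0].
rewrite -(ler_pM2r dir_gt0) mul1r -expr2 enorm_sqr {1}/zbar /= dotpZl dotp_suml.
rewrite -lerN2 -mulrN -sumrN; apply: sum_le => t /feas[_ dir_le _ _].
rewrite lerN2; apply: (le_trans (dotp_le _ _)).
by rewrite -[leRHS]mul1r ler_pM2r.
Qed.

Lemma test_below_pd p : test_below P Q alpha eps' p ->
  pd_feasible p /\ pd_value P Q p < alpha.
Proof.
move=> [x [t [+ _ opt val_lt0 ->]]]; case: t opt val_lt0 => // t opt val_lt0 _.
have w_gt0 := weights_gt0 x t; apply: below_pd opt val_lt0 => //.
- rewrite /entry_sum (bigD1 (Ordinal n1_gt0)) //=; apply: ltr_wpDr.
    by apply: sumr_ge0 => j _; have := ltW (w_gt0 (lshift _ j)); rewrite col_mxEu.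
  by have := w_gt0 (lshift _ (Ordinal n1_gt0)); rewrite col_mxEu.
- rewrite /entry_sum (bigD1 (Ordinal n2_gt0)) //=; apply: ltr_wpDr.
    by apply: sumr_ge0 => j _; have := ltW (w_gt0 (rshift _ j)); rewrite col_mxEd.
  by have := w_gt0 (rshift _ (Ordinal n2_gt0)); rewrite col_mxEd.
- by move=> j; have := ltW (w_gt0 (lshift _ j)); rewrite col_mxEu.
- by move=> j; have := ltW (w_gt0 (rshift _ j)); rewrite col_mxEd.
Qed.

End Test.

(** The invariant speaks of the two solutions instead of the optimum, which lies between their
    values. In a middle third eps' alpha = (U - L) / 3 <= 2 D / 3, as the analysis of the test
    requires. *)
Lemma search_correct L U z p :
    (0 < n1)%N -> (0 < n2)%N -> 0 < D -> search P Q L U z p ->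
  [/\ svm_feasible P Q z, L <= svm_value z, pd_feasible p, pd_value P Q p <= U
    & [/\ 0 <= L, L < U & U <= 2 * D]].
Proof.
move=> n1_gt0 n2_gt0 D_gt0.
elim=> {L U z p} [p p_feas|L U z p alpha e p'|L U z p alpha e z'].
- split=> //; last by split; rewrite // mulr_gt0.
  + split=> [j|j|] /=.
    * by rewrite slackPE /= dotp0r subr0.
    * by rewrite slackQE /= dotp0r oppr0 addr0.
    * by rewrite enorm0.
  + by rewrite /svm_value /= addr0.
  + exact: pd_value_le.
- move=> _ [? ? ? ? [L_ge0 LU U_le]] [mid1 mid2] below.
  have alpha_gt0 : 0 < alpha by lra.
  have [p_feas p_lt] := test_below_pd n1_gt0 n2_gt0 alpha_gt0 below.
  by split=> //; [exact: ltW | split=> //; lra].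
- move=> _ [? ? ? ? [L_ge0 LU U_le]] [mid1 mid2] above.
  have alpha_gt0 : 0 < alpha by lra.
  have tol : e * alpha = (U - L) / 3 by lra.
  have [||z_feas z_ge] :=
    @test_above_svm alpha e n1_gt0 n2_gt0 D_gt0 alpha_gt0 _ _ z' above;
    rewrite ?tol; try lra.
  by split=> //; split; lra.
Qed.

(** Both values and [OPT] lie in [L, U], whose length is at most eps OPT. *)
Lemma meta_algorithm_correct OPT eps z p :
    (0 < n1)%N -> (0 < n2)%N -> 0 < D -> svm_optimum P Q OPT -> pd_optimum P Q OPT ->
    meta_algorithm P Q OPT eps z p ->
  svm_approx P Q OPT eps z /\ pd_approx P Q OPT eps p.
Proof.
move=> n1_gt0 n2_gt0 D_gt0 [_ svm_ub] [_ pd_lb] [L [U [LU_search LU_le]]].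
have [z_feas z_ge p_feas p_le _] := search_correct n1_gt0 n2_gt0 D_gt0 LU_search.
have z_le : svm_value z <= OPT by apply: svm_ub; exists z.
have p_ge : OPT <= pd_value P Q p by apply: pd_lb; exists p.
by split; split=> //; lra.
Qed.

End Correctness.

(** * Registers and parallel instructions *)

(* A register is an entry of a bank; a vector is row 0 of its bank, and a scalar is
   entry (0, 0).  rA holds the augmented matrix, rX, rY, rZ, rR, rN, r1, r2 are
   scratch, rS sums the slacks, rP and rG are the weights and their image, rW
   and rV the last oracle solution and the sum of all, rO and rQ the outputs, rT the
   number of iterations, rt that of the completed ones, rK is - eta / rho. *)
Inductive bank :=
| rA | rX | rY | rZ | rS | rP | rG | rW | rV | rR | rO | rQ
| rD | rL | rU | rGap | rThr | rTol | rAlpha | rBound | rT | rt | rK | rLow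
| rN | rVal | r1 | r2.

(** The encoding makes [bank], and hence [reg], a choice type, as the passage to finitely many
    registers requires. *)
Definition bank_code (t : bank) : nat :=
  match t with
  | rA => 0 | rX => 1 | rY => 2 | rZ => 3 | rS => 4 | rP => 5 | rG => 6 | rW => 7
  | rV => 8 | rR => 9 | rO => 10 | rQ => 11 | rD => 12 | rL => 13 | rU => 14
  | rGap => 15 | rThr => 16 | rTol => 17 | rAlpha => 18 | rBound => 19 | rT => 20
  | rt => 21 | rK => 22 | rLow => 23 | rN => 24 | rVal => 25 | r1 => 26 | r2 => 27
  end.

Definition bank_decode (k : nat) : bank :=
  nth rA [:: rA; rX; rY; rZ; rS; rP; rG; rW; rV; rR; rO; rQ; rD; rL; rU; rGap;
    rThr; rTol; rAlpha; rBound; rT; rt; rK; rLow; rN; rVal; r1; r2] k.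

Lemma bank_codeK : cancel bank_code bank_decode.
Proof. by case. Qed.

HB.instance Definition _ := Countable.copy bank (can_type bank_codeK).

Definition reg := (bank * nat * nat)%type.

Section Instructions.
Variables (R : realType) (X : Type) (x : X -> R).
Implicit Types (m : reg -> R) (w s : nat) (t : bank).
Implicit Types (Q : (reg -> R) -> nat -> nat -> Prop).

Local Notation cmd := (cmd reg X).
Local Notation opd := (operand reg X).
Local Notation op := (operation opd).
Local Notation wp := (wp x).

Definition arr t i j : opd := Reg X (t, i, j).
Definition sc t : opd := arr t 0 0.

Definition frame (F : seq bank) m m' : Prop :=
  forall t i j, t \notin F -> m' (t, i, j) = m (t, i, j).

Definition upd m (r : reg) (v : R) : reg -> R :=
  fun u => if u == r then v else m u.

Definition cells t a b : seq reg := [seq (t, i, j) | i <- iota 0 a, j <- iota 0 b].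

Definition vec t a b (o : nat -> nat -> op) : cmd :=
  layer (cells t a b) (fun r => o r.1.2 r.2).

Definition assign (r : reg) (o : op) : cmd := layer [:: r] (fun=> o).

Lemma mem_cells t a b t' i j :
  ((t', i, j) \in cells t a b) = [&& t' == t, (i < a)%N & (j < b)%N].
Proof.
apply/allpairsP/and3P => [[[i' j'] [/=]]|[/eqP-> ia jb]].
  by rewrite !mem_iota !add0n /= => ia jb [-> -> ->].
by exists (i, j); rewrite !mem_iota.
Qed.

Lemma size_cells t a b : size (cells t a b) = (a * b)%N.
Proof. by rewrite size_allpairs !size_iota. Qed.

Lemma uniq_cells t a b : uniq (cells t a b).
Proof. by apply: allpairs_uniq; rewrite ?iota_uniq // => -[i j] [i' j'] _ _ [-> ->]. Qed.

(** An operation may read its own target, which allows updates in place, but no other cell of the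
    layer. *)
Lemma wp_vec t a b (o : nat -> nat -> op) Q m w s :
    (forall i j, (i < a)%N -> (j < b)%N ->
       op_defined (value x m) (o i j)) ->
    (forall i j i' j', (i < a)%N -> (j < b)%N -> (i' < a)%N -> (j' < b)%N ->
       (t, i', j') \in reads (o i j) -> i' = i /\ j' = j) ->
    (forall m',
       (forall i j, (i < a)%N -> (j < b)%N ->
          m' (t, i, j) = op_value (value x m) (o i j)) ->
       (forall i j, ~~ ((i < a)%N && (j < b)%N) -> m' (t, i, j) = m (t, i, j)) ->
       frame [:: t] m m' -> Q m' (w + a * b)%N s.+1) ->
  wp (vec t a b o) Q m w s.
Proof.
move=> def_o read_o Qm; apply: wp_layer.
- exact: uniq_cells.
- by move=> [[t' i] j]; rewrite mem_cells => /and3P[_ ia jb]; exact: def_o.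
- move=> [[t' i] j] [[t'' i'] j']; rewrite !mem_cells.
  move=> /and3P[/eqP-> ia jb] r /and3P[/eqP tt ia' jb']; rewrite tt in r *.
  by have [-> ->] := read_o _ _ _ _ ia jb ia' jb' r.
rewrite size_cells; apply: Qm => [i j ia jb|i j /negbTE ij|t' i j].
- by rewrite mem_cells eqxx ia jb.
- by rewrite mem_cells ij andbF.
- by rewrite mem_cells inE => /negbTE ->.
Qed.

Lemma wp_assign r (o : op) Q m w s :
  op_defined (value x m) o -> Q (upd m r (op_value (value x m) o)) w.+1 s.+1 ->
  wp (assign r o) Q m w s.
Proof.
move=> def_o Qm; apply: wp_layer => [//|//|v u|].
  by rewrite !inE => /eqP-> _ /eqP->.
rewrite addn1; move: Qm; congr Q; apply/funext => v.
by rewrite /upd inE; case: eqP => // ->.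
Qed.

(** * Tree reductions *)

(** [k] is fuel and [m] the current length. The steps used below fold entry j + uphalf m onto entry
    j for j < m./2; the middle entry of an odd length stays in place. *)
Fixpoint reduce (step : nat -> cmd) (k m : nat) : cmd :=
  if k is k'.+1 then
    if (m <= 1)%N then Skip else Seq (step m) (reduce step k' (uphalf m))
  else Skip.

Fixpoint depth_rec (k m : nat) : nat :=
  if k is k'.+1 then if (m <= 1)%N then 0%N else (depth_rec k' (uphalf m)).+1
  else 0%N.

Definition depth (k : nat) := depth_rec k k.

Lemma depth_le n : (0 < n)%N -> (2 ^ depth n <= 2 * n)%N.
Proof.
(* The bound 2 (p - 1) is inductive, since uphalf p - 1 is at most half of p - 1; the maximum covers
   p <= 1. *)
suff le_rec k p : (2 ^ depth_rec k p <= maxn 1 (2 * p.-1))%N.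
  by have := le_rec n n; rewrite /depth; lia.
elim: k p => [|k IHk] p /=; first by lia.
case: (leqP p 1%N) => [|p_gt1]; first by lia.
have := IHk (uphalf p); rewrite expnS; have := uphalfE p; lia.
Qed.

(** A step pays [c] operations per pair and removes [k./2] entries from each row, so the work
    telescopes to [k.-1] pairs per row, while each level of the tree costs [c] in span. [Inv i k]
    describes what the first [k] entries of row [i] still determine. *)
Lemma wp_reduce (step : nat -> cmd) (F : seq bank) t a c (f : R -> R -> R)
    (Inv : nat -> nat -> (nat -> R) -> Prop) :
    (forall k m w s Q, (1 < k)%N ->
       (forall m',
          (forall i j, (i < a)%N -> (j < k./2)%N ->
             m' (t, i, j) = f (m (t, i, j)) (m (t, i, j + uphalf k)%N)) ->
          (forall i j, (i < a)%N -> (k./2 <= j)%N -> m' (t, i, j) = m (t, i, j)) ->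
          frame F m m' -> Q m' (w + c * (a * k./2))%N (s + c)%N) ->
       wp (step k) Q m w s) ->
    (forall i k (u v : nat -> R), (1 < k)%N ->
       (forall j, (j < k./2)%N -> v j = f (u j) (u (j + uphalf k)%N)) ->
       (forall j, (k./2 <= j)%N -> v j = u j) ->
       Inv i k u -> Inv i (uphalf k) v) ->
  forall n k m w s Q, (0 < k <= n)%N ->
    (forall i, (i < a)%N -> Inv i k (fun j => m (t, i, j))) ->
    (forall m', (forall i, (i < a)%N -> Inv i 1%N (fun j => m' (t, i, j))) ->
       frame F m m' -> Q m' (w + c * (a * k.-1))%N (s + c * depth_rec n k)%N) ->
  wp (reduce step n k) Q m w s.
Proof.
move=> wp_step Inv_step; elim=> [|n IHn] k m w s Q /andP[k_gt0 kn] Ik Qm /=.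
  by rewrite leqn0 in kn; rewrite (eqP kn) in k_gt0.
move: Qm => /=; case: (leqP k 1%N) => [k1 Qm|k_gt1 Qm].
  have k1E : k = 1%N by lia.
  apply: wp_skip; rewrite -[w]addn0 -[s]addn0.
  have := Qm m; rewrite k1E !muln0; apply=> //; by rewrite -k1E.
apply: wp_seq; apply: wp_step => // m' m'lo m'hi m'F.
apply: IHn; first by have := uphalfE k; lia.
  by move=> i ia; apply: Inv_step (Ik i ia) => // j; [exact: m'lo | exact: m'hi].
move=> m'' Im'' m''F.
have -> : (w + c * (a * k./2) + c * (a * (uphalf k).-1) = w + c * (a * k.-1))%N.
  rewrite -addnA -!mulnDr; congr (_ + _ * (_ * _))%N; have := uphalfE k; lia.
rewrite -addnA -mulnS; apply: Qm => // u i j uF.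
by rewrite m''F // m'F.
Qed.

Definition add_step t a k : cmd :=
  vec t a k./2 (fun i j => OpAdd (arr t i j) (arr t i (j + uphalf k))).

(* max(u, v) = u + [u < v] (v - u), so that no branching is needed. *)
Definition max_step t a k : cmd :=
  let u i j := arr t i j in
  let v i j := arr t i (j + uphalf k) in
  Seq (vec rY a k./2 (fun i j => OpLt (u i j) (v i j)))
 (Seq (vec rZ a k./2 (fun i j => OpSub (v i j) (u i j)))
 (Seq (vec rY a k./2 (fun i j => OpMul (arr rY i j) (arr rZ i j)))
      (vec t a k./2 (fun i j => OpAdd (u i j) (arr rY i j))))).

Lemma wp_add_step t a k m w s Q :
    (forall m',
       (forall i j, (i < a)%N -> (j < k./2)%N ->
          m' (t, i, j) = m (t, i, j) + m (t, i, j + uphalf k)%N) ->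
       (forall i j, (i < a)%N -> (k./2 <= j)%N -> m' (t, i, j) = m (t, i, j)) ->
       frame [:: t] m m' -> Q m' (w + 1 * (a * k./2))%N (s + 1)%N) ->
  wp (add_step t a k) Q m w s.
Proof.
move=> Qm; apply: wp_vec => // [i j i' j' ia jk ia' jk'|m' m'lo m'hi m'F].
  by rewrite !inE => /orP[/eqP[-> ->]//|/eqP[_ jE]]; have := uphalfE k; lia.
rewrite -[(a * _)%N]mul1n -[s.+1]addn1; apply: Qm => // i j ia kj; apply: m'hi.
by rewrite negb_and -!leqNgt kj orbT.
Qed.

Lemma wp_max_step t a k m w s Q : t \notin [:: rY; rZ] ->
    (forall m',
       (forall i j, (i < a)%N -> (j < k./2)%N ->
          m' (t, i, j) = Num.max (m (t, i, j)) (m (t, i, j + uphalf k)%N)) ->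
       (forall i j, (i < a)%N -> (k./2 <= j)%N -> m' (t, i, j) = m (t, i, j)) ->
       frame [:: t; rY; rZ] m m' -> Q m' (w + 4 * (a * k./2))%N (s + 4)%N) ->
  wp (max_step t a k) Q m w s.
Proof.
rewrite !inE negb_or => /andP[tY tZ] Qm.
have [Yt Zt] : (rY == t) = false /\ (rZ == t) = false.
  by rewrite ![_ == t]eq_sym (negbTE tY) (negbTE tZ).
apply: wp_seq; apply: wp_vec => // [i j i' j' _ _ _ _ ijr|m1 m1E _ m1F].
  by move: ijr; rewrite !inE !xpair_eqE Yt.
apply: wp_seq; apply: wp_vec => // [i j i' j' _ _ _ _ ijr|m2 m2E _ m2F].
  by move: ijr; rewrite !inE !xpair_eqE Zt.
apply: wp_seq; apply: wp_vec => // [i j i' j' _ _ _ _ ijr|m3 m3E _ m3F].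
  by move: ijr; rewrite !inE !xpair_eqE => /orP[] /andP[/andP[? /eqP->] /eqP->].
apply: wp_vec => // [i j i' j' _ _ _ _ ijr|m4 m4E m4hi m4F].
  by move: ijr; rewrite !inE !xpair_eqE (negbTE tY) orbF => /andP[/andP[? /eqP->] /eqP->].
have -> : (w + a * k./2 + a * k./2 + a * k./2 + a * k./2 = w + 4 * (a * k./2))%N by lia.
rewrite -[s.+4]addn4.
have m3t i j : m3 (t, i, j) = m (t, i, j).
  by rewrite m3F ?inE // m2F ?inE // m1F ?inE.
apply: Qm => [i j ia jk|i j ia jk|t' i j].
- rewrite m4E //= m3E //= m3t m2F // m1E //= m2E //= !(m1F t) ?inE //.
  by case: ltP => [/ltW|] le_uv; rewrite ?mul1r ?mul0r ?addr0 // addrC subrK.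
- by rewrite m4hi ?m3t // negb_and -!leqNgt jk orbT.
- rewrite !inE !negb_or => /and3P[t't t'Y t'Z].
  by rewrite m4F ?inE // m3F ?inE // m2F ?inE // m1F ?inE.
Qed.

(** * Parallel inner products *)

(** Adding zero stands for a copy, here and below, because every assignment performs an
    operation. *)
Definition sums (a b : nat) (u v : nat -> nat -> opd) (dst : bank) : cmd :=
  Seq (vec rX a b (fun i j => OpMul (u i j) (v i j)))
 (Seq (reduce (add_step rX a) b b)
      (vec dst 1 a (fun _ i => OpAdd (arr rX i 0) (Cst reg X 0)))).

Definition sums_work (a b : nat) : nat := (2 * (a * b) + a)%N.
Definition sums_span (b : nat) : nat := (depth b + 2)%N.

Lemma wp_sums a b (u v : nat -> nat -> opd) dst m w s Q : (0 < b)%N -> dst != rX ->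
    (forall i j i' j', (rX, i', j') \notin reads (OpMul (u i j) (v i j))) ->
    (forall m', (forall i, (i < a)%N ->
         m' (dst, 0, i)%N = \sum_(j < b) value x m (u i j) * value x m (v i j)) ->
       frame [:: rX; dst] m m' ->
       forall w', (w' <= w + sums_work a b)%N -> Q m' w' (s + sums_span b)%N) ->
  wp (sums a b u v dst) Q m w s.
Proof.
move=> b_gt0 dstX uvX Qm.
apply: wp_seq; apply: wp_vec => // [i j i' j' _ _ _ _|m1 m1E _ m1F].
  by rewrite (negbTE (uvX _ _ _ _)).
pose S i k (r : nat -> R) :=
  \sum_(j < k) r j = \sum_(j < b) value x m (u i j) * value x m (v i j).
apply: wp_seq; apply: (@wp_reduce _ [:: rX] rX a 1 +%R S) => //.
- by move=> k m' w' s' Q' k_gt1; exact: wp_add_step.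
- move=> i k p q k_gt1 qlo qhi; rewrite /S => <-.
  rewrite -!(big_mkord xpredT) /=.
  (* The range from [k./2] to [uphalf k] holds the unpaired middle entry of an odd length. *)
  have kE := uphalfE k; rewrite (@big_cat_nat _ _ _ k./2 0 (uphalf k)) //=; last by lia.
  rewrite [in RHS](@big_cat_nat _ _ _ (uphalf k) 0 k) //=; last by lia.
  rewrite [in RHS](@big_cat_nat _ _ _ k./2 0 (uphalf k)) //=; last by lia.
  rewrite addrAC; congr (_ + _); last first.
    by rewrite !big_nat; apply: eq_bigr => j /andP[/qhi].
  rewrite -{1}[uphalf k]add0n big_addn.
  have -> : (k - uphalf k = k./2)%N by lia.
  rewrite -big_split /=.
  by rewrite !big_nat; apply: eq_bigr => j /andP[_ /qlo].
- by rewrite b_gt0 /=.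
- move=> i ia; apply: eq_bigr => j _; exact: m1E.
move=> m2 m2E m2F; apply: wp_vec => // [i j i' j' _ _ _ _|m3 m3E _ m3F].
  by rewrite !inE !xpair_eqE (negbTE dstX).
have <- : (s + sums_span b = (s.+1 + 1 * depth_rec b b).+1)%N.
  by rewrite /sums_span /depth; lia.
apply: Qm => [i ia|t i j|].
- by rewrite m3E //= addr0 -(m2E i ia) big_ord1.
- by rewrite !inE negb_or => /andP[tX tdst]; rewrite m3F ?inE // m2F ?inE // m1F ?inE.
- by rewrite /sums_work; nia.
Qed.

End Instructions.

(** * The augmented matrix *)

Section Augmented.
Variables (R : realType) (d n1 n2 : nat) (P : 'M[R]_(d, n1)) (Q : 'M[R]_(d, n2)).
Implicit Types (w p g : nat -> R) (q : pd_point R n1 n2) (z : svm_point R d).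

Let D := max_norm P Q.

(* With u_j the columns of P and v_j those of Q, the columns are (u_j; 1; 0) and
   (-v_j; 0; 1), so that their products with (w; -s1; -s2) are the slacks. *)
Definition augmented (i j : nat) : R :=
  if insub i is Some i' then
    if insub j is Some j' then P i' j'
    else if insub (j - n1)%N is Some j' then - Q i' j' else 0
  else ((i == d) == (j < n1)%N)%:R.

Definition svm_of w : svm_point R d :=
  SvmPoint (\col_(i < d) w i) (- w d) (- w d.+1).

Definition pd_of p : pd_point R n1 n2 :=
  PdPoint (\col_(j < n1) p j) (\col_(j < n2) p (n1 + j)%N).

Definition aug_mul p (i : nat) : R := \sum_(j < n1 + n2) augmented i j * p j.

Definition aug_slack w (j : nat) : R := \sum_(i < d.+2) augmented i j * w i.

Lemma augmentedP (i : 'I_d) (j : 'I_n1) : augmented i j = P i j.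
Proof. by rewrite /augmented !valK. Qed.

Lemma augmentedQ (i : 'I_d) (j : 'I_n2) : augmented i (n1 + j) = - Q i j.
Proof.
rewrite /augmented valK insubF ?addKn ?valK //.
by rewrite ltnNge leq_addr.
Qed.

Lemma augmented_d j : augmented d j = (j < n1)%N%:R.
Proof. by rewrite /augmented insubF ?ltnn // eqxx; case: (j < n1)%N; rewrite ?eqxx. Qed.

Lemma augmented_d1 j : augmented d.+1 j = (n1 <= j)%N%:R.
Proof.
rewrite /augmented insubF; last by apply/negbTE; lia.
have -> : (d.+1 == d) = false by lia.
by rewrite (leqNgt n1); case: (j < n1)%N; rewrite ?eqxx.
Qed.

Lemma wvec_pd_of p (j : 'I_(n1 + n2)) : wvec (pd_of p) j 0 = p j.
Proof.
by rewrite -[j]splitK; case: (split j) => k; rewrite /= ?col_mxEu ?col_mxEd mxE.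
Qed.

Lemma slack_svm_of w (j : 'I_(n1 + n2)) : slack P Q (svm_of w) j 0 = aug_slack w j.
Proof.
rewrite /aug_slack !big_ord_recr /= augmented_d augmented_d1.
rewrite -[j]splitK; case: (split j) => k /=.
  rewrite col_mxEu slackPE /= ltn_ord leqNgt ltn_ord mul1r mul0r addr0.
  by rewrite opprK; congr (_ + _); apply: eq_bigr => i _; rewrite !mxE augmentedP.
rewrite col_mxEd slackQE /= ltnNge leq_addr mul1r mul0r addr0 opprK.
congr (_ + _); rewrite /dotp -sumrN; apply: eq_bigr => i _.
by rewrite !mxE augmentedQ mulNr.
Qed.

Lemma aug_mul_dir p (i : 'I_d) :
  (P *m muw (pd_of p) - Q *m gamw (pd_of p)) i 0 = aug_mul p i.
Proof.
rewrite /aug_mul big_split_ord /= !mxE -sumrN; congr (_ + _); apply: eq_bigr => j _.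
  by rewrite mxE augmentedP.
by rewrite mxE augmentedQ mulNr.
Qed.

Lemma aug_mul_mu p : aug_mul p d = entry_sum (muw (pd_of p)).
Proof.
rewrite /aug_mul big_split_ord /= [X in _ + X]big1 ?addr0 => [|j _].
  by apply: eq_bigr => j _; rewrite mxE augmented_d ltn_ord mul1r.
by rewrite augmented_d ltnNge leq_addr mul0r.
Qed.

Lemma aug_mul_gam p : aug_mul p d.+1 = entry_sum (gamw (pd_of p)).
Proof.
rewrite /aug_mul big_split_ord /= [X in X + _]big1 ?add0r => [|j _].
  by apply: eq_bigr => j _; rewrite mxE augmented_d1 leq_addr mul1r.
by rewrite augmented_d1 leqNgt ltn_ord mul0r.
Qed.

Lemma oracle_value_of p w :
  oracle_value P Q (pd_of p) (svm_of w) = \sum_(i < d.+2) aug_mul p i * w i.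
Proof.
rewrite oracle_valueE; under eq_bigr do rewrite wvec_pd_of slack_svm_of mulr_sumr.
rewrite exchange_big; apply: eq_bigr => i _; rewrite mulr_suml.
by apply: eq_bigr => j _; ring.
Qed.

Lemma scale_wvec q q' (c : R) :
  (forall j, wvec q j 0 = c * wvec q' j 0) ->
  q = PdPoint (c *: muw q') (c *: gamw q').
Proof.
case: q => mu gam qE; congr PdPoint; apply/colP => j; rewrite mxE.
  by have := qE (lshift _ j); rewrite !col_mxEu.
by have := qE (rshift _ j); rewrite !col_mxEd.
Qed.

(** Transfers signs and maximizers between the normalized weights of the algorithm and those of the
    program. *)
Lemma oracle_value_scale (c : R) q z :
  oracle_value P Q (PdPoint (c *: muw q) (c *: gamw q)) z = c * oracle_value P Q q z.
Proof.
rewrite !oracle_valueE mulr_sumr; apply: eq_bigr => j _; rewrite mulrA; congr (_ * _).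
by rewrite -[j]splitK; case: (split j) => k; rewrite /= ?col_mxEu ?col_mxEd mxE.
Qed.

Lemma normalize_scale (c : R) q : c != 0 ->
  normalize (PdPoint (c *: muw q) (c *: gamw q)) = normalize q.
Proof.
move=> c_neq0; have scale_sum k (v : 'cV[R]_k) : (entry_sum (c *: v))^-1 *: (c *: v)
    = (entry_sum v)^-1 *: v.
  rewrite /entry_sum; under eq_bigr do rewrite mxE.
  by rewrite -mulr_sumr scalerA invfM mulrAC mulVf // mul1r.
by rewrite /normalize /= !scale_sum.
Qed.

(** The value splits. The term in the direction is maximal by Cauchy-Schwarz. The term - a s1 - b s2
    is maximal when s1 + s2 = alpha and the offset with the smaller coefficient equals D; the other
    is alpha - D, which is at most D. *)
Lemma oracle_closed_form (alpha : R) q z : let h := P *m muw q - Q *m gamw q in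
    alpha <= 2 * D -> 0 <= entry_sum (muw q) -> 0 <= entry_sum (gamw q) ->
    dotp h (dir z) = enorm h -> enorm (dir z) <= 1 ->
    off1 z = (if entry_sum (gamw q) < entry_sum (muw q) then alpha - D else D) ->
    off2 z = alpha - off1 z ->
  oracle_optimal P Q alpha q z.
Proof.
move=> h alpha_le; set a := entry_sum _; set b := entry_sum _ => a_ge0 b_ge0.
move=> dotE dir_le off1E off2E; split.
  split; rewrite // ?off2E ?off1E.
  - by rewrite addrC subrK.
  - by rewrite -/D; case: ifP alpha_le => _; move: (D) => u; lra.
  - by rewrite -/D; case: ifP alpha_le => _; move: (D) => u; lra.
move=> z' [sum_ge dir'_le off1_le off2_le].
rewrite /oracle_value -/h -/a -/b -/D in off1_le off2_le *.
rewrite dotE -!addrA; apply: lerD.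
  apply: (le_trans (dotp_le _ _)); rewrite -[leRHS]mulr1.
  by apply: ler_wpM2l; first exact: enorm_ge0.
rewrite off2E off1E; case: ltP => ab; move: (D) off1_le off2_le ab => u; nra.
Qed.

(** The closed form in machine arithmetic: cases become factors 0 or 1 given by comparisons, and the
    entries [d] and [d.+1] hold the negated offsets. *)
Lemma oracle_optimal_of (alpha : R) p w : let g := aug_mul p in
    alpha <= 2 * D -> (forall j, 0 <= p j) ->
    (forall i, (i < d)%N -> w i = g i / (Num.sqrt (\sum_(i < d) g i * g i) + 1
       - (if 0 < Num.sqrt (\sum_(i < d) g i * g i) then 1 else 0))) ->
    w d = (if g d.+1 < g d then 1 else 0) * (2 * D - alpha) - D ->
    w d.+1 = - (w d + alpha) ->
  oracle_optimal P Q alpha (pd_of p) (svm_of w).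
Proof.
move=> g alpha_le p_ge0 wE wd wd1.
set h := P *m muw (pd_of p) - Q *m gamw (pd_of p).
have hE : enorm h = Num.sqrt (\sum_(i < d) g i * g i).
  by congr Num.sqrt; apply: eq_bigr => i _; rewrite aug_mul_dir expr2.
rewrite -hE in wE; set c := enorm h + 1 - _ in wE.
have dirE : dir (svm_of w) = c^-1 *: h.
  by apply/colP => i; rewrite [RHS]mxE aug_mul_dir mxE wE // mulrC.
have [dotE dir_le] : dotp h (dir (svm_of w)) = enorm h /\ enorm (dir (svm_of w)) <= 1.
  rewrite dirE dotpZr -enorm_sqr enormZ /c; have := enorm_ge0 h.
  rewrite le_eqVlt => /predU1P[<-|h_gt0]; first by rewrite expr0n !mulr0 ler01.
  rewrite h_gt0 addrK expr2 mulrA gtr0_norm ?invr_gt0 //.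
  by rewrite mulVf ?mul1r // gt_eqF.
apply: oracle_closed_form => //.
- by apply: sumr_ge0 => j _; rewrite mxE.
- by apply: sumr_ge0 => j _; rewrite mxE.
- rewrite -aug_mul_mu -aug_mul_gam -/g /= wd -/D; case: ifP => _; ring.
- by rewrite /= wd1; ring.
Qed.

End Augmented.

(** * The program *)

Local Notation "c1 ;; c2" := (Seq c1 c2) (at level 61, right associativity).

Section Code.
Variables (d n1 n2 : nat).
Local Notation n := (n1 + n2)%N.
Local Notation X := (svm_index d n1 n2).
Local Notation opd := (operand reg X).
Local Notation sc := (@sc X).
Local Notation arr := (@arr X).
Local Notation num k := (Cst reg X k).
Local Notation "r <~ o" := (assign (r, 0, 0)%N o) (at level 60).

Definition entry (i j : nat) : operation opd :=
  if insub i is Some i' then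
    if insub j is Some j' then OpAdd (Inp reg (InP n2 i' j')) (num 0)
    else if insub (j - n1)%N is Some j' then OpSub (num 0) (Inp reg (InQ n1 i' j'))
    else OpAdd (num 0) (num 0)
  else OpAdd (num ((i == d) == (j < n1)%N)) (num 0).

Definition weigh : cmd reg X :=
  vec rR 1 n (fun _ j => OpMul (arr rS 0 j) (sc rK)) ;;
  vec rP 1 n (fun _ j => OpExp (arr rR 0 j)) ;;
  sums d.+2 n (arr rA) (fun _ j => arr rP 0 j) rG.

(* Adding 1 - [0 < |h|] to the norm |h| avoids dividing by zero. *)
Definition direct : cmd reg X :=
  sums 1 d (fun _ i => arr rG 0 i) (fun _ i => arr rG 0 i) rN ;;
  rN <~ OpSqrt (sc rN) ;;
  r1 <~ OpLt (num 0) (sc rN) ;;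
  rN <~ OpAdd (sc rN) (num 1) ;;
  rN <~ OpSub (sc rN) (sc r1) ;;
  vec rW 1 d (fun _ i => OpDiv (arr rG 0 i) (sc rN)) ;;
  r1 <~ OpLt (arr rG 0 d.+1) (arr rG 0 d) ;;
  r2 <~ OpAdd (sc rD) (sc rD) ;;
  r2 <~ OpSub (sc r2) (sc rAlpha) ;;
  r1 <~ OpMul (sc r1) (sc r2) ;;
  assign (rW, 0, d)%N (OpSub (sc r1) (sc rD)) ;;
  r2 <~ OpAdd (arr rW 0 d) (sc rAlpha) ;;
  assign (rW, 0, d.+1)%N (OpSub (num 0) (sc r2)).

(** A loop has no early exit, so a negative value raises the flag [rLow] and moves the counter to
    [rT], which makes the guard fail. *)
Definition iteration : cmd reg X :=
  weigh ;; direct ;;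
  sums 1 d.+2 (fun _ i => arr rG 0 i) (fun _ i => arr rW 0 i) rVal ;;
  If (sc rVal) (num 0)
    (rLow <~ OpAdd (num 1) (num 0) ;;
     rt <~ OpAdd (sc rT) (num 0))
    (sums n d.+2 (fun j i => arr rA i j) (fun _ i => arr rW 0 i) rR ;;
     vec rS 1 n (fun _ j => OpAdd (arr rS 0 j) (arr rR 0 j)) ;;
     vec rV 1 d.+2 (fun _ i => OpAdd (arr rV 0 i) (arr rW 0 i)) ;;
     rt <~ OpAdd (sc rt) (num 1)).

Definition prepare : cmd reg X :=
  rTol <~ OpSub (sc rU) (sc rL) ;;
  rTol <~ OpDiv (sc rTol) (num 3) ;;
  rAlpha <~ OpSub (sc rU) (sc rTol) ;;
  r1 <~ OpMul (sc rD) (sc rD) ;;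
  r1 <~ OpMul (sc r1) (num 64) ;;
  r1 <~ OpMul (sc r1) (Inp reg (InLn d n1 n2)) ;;
  r2 <~ OpMul (sc rTol) (sc rTol) ;;
  rBound <~ OpDiv (sc r1) (sc r2) ;;
  rT <~ OpAdd (num 0) (num 0).

(** Its cost is linear in T, like that of the test loop that follows. *)
Definition count_rounds : cmd reg X :=
  While (sc rT) (sc rBound) (rT <~ OpAdd (sc rT) (num 1)).

Definition rescale : cmd reg X :=
  rK <~ OpDiv (Inp reg (InLn d n1 n2)) (sc rT) ;;
  rK <~ OpSqrt (sc rK) ;;
  r1 <~ OpAdd (sc rD) (sc rD) ;;
  rK <~ OpDiv (sc rK) (sc r1) ;;
  rK <~ OpSub (num 0) (sc rK) ;;
  rLow <~ OpAdd (num 0) (num 0) ;;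
  rt <~ OpAdd (num 0) (num 0) ;;
  vec rS 1 n (fun _ _ => OpAdd (num 0) (num 0)) ;;
  vec rV 1 d.+2 (fun _ _ => OpAdd (num 0) (num 0)).

(** In the second branch [rV] holds sums of negated offsets, so that - (V / T + tol / 2) is the
    average offset minus tol / 2. *)
Definition conclude : cmd reg X :=
  If (num 0) (sc rLow)
    (rU <~ OpAdd (sc rAlpha) (num 0) ;;
     vec rQ 1 n (fun _ j => OpDiv (arr rP 0 j)
       (arr rG 0 (if (j < n1)%N then d else d.+1))))
    (rL <~ OpSub (sc rAlpha) (sc rTol) ;;
     r1 <~ OpDiv (sc rTol) (num 2) ;;
     vec rO 1 d.+2 (fun _ i => OpDiv (arr rV 0 i) (sc rT)) ;;
     assign (rO, 0, d)%N (OpAdd (arr rO 0 d) (sc r1)) ;;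
     assign (rO, 0, d)%N (OpSub (num 0) (arr rO 0 d)) ;;
     assign (rO, 0, d.+1)%N (OpAdd (arr rO 0 d.+1) (sc r1)) ;;
     assign (rO, 0, d.+1)%N (OpSub (num 0) (arr rO 0 d.+1))).

Definition phase : cmd reg X :=
  prepare ;; count_rounds ;; rescale ;; While (sc rt) (sc rT) iteration ;; conclude ;;
  rGap <~ OpSub (sc rU) (sc rL) ;;
  rThr <~ OpMul (Inp reg (InEps d n1 n2)) (sc rL).

(** Registers start at zero, the right value for [rL], [rThr] and [rO]. The initial solution of (PD)
    puts all weight on the first point of each set. *)
Definition initialize : cmd reg X :=
  vec rA d.+2 n entry ;;
  sums n d (fun j i => arr rA i j) (fun j i => arr rA i j) rR ;;
  vec rX 1 n (fun _ j => OpSqrt (arr rR 0 j)) ;;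
  reduce (max_step X rX 1) n n ;;
  rD <~ OpAdd (sc rX) (num 0) ;;
  rU <~ OpAdd (sc rD) (sc rD) ;;
  rGap <~ OpAdd (sc rU) (num 0) ;;
  rQ <~ OpAdd (num 1) (num 0) ;;
  assign (rQ, 0, n1)%N (OpAdd (num 1) (num 0)).

Definition main : cmd reg X := initialize ;; While (sc rThr) (sc rGap) phase.

Definition outputs (k : sol_index d n1 n2) : opd :=
  match k with
  | OutDir i => arr rO 0 i
  | OutOff1 => arr rO 0 d
  | OutOff2 => arr rO 0 d.+1
  | OutMu j => arr rQ 0 j
  | OutGam j => arr rQ 0 (n1 + j)
  end.

Definition meta_program : program X (sol_index d n1 n2) :=
  finite_program main (cells rO 1 d.+2 ++ cells rQ 1 n) outputs.

End Code.

(** * Weights and closed-form oracle: effect and cost *)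

Section Blocks.
Variables (R : realType) (d n1 n2 : nat) (P : 'M[R]_(d, n1)) (Q : 'M[R]_(d, n2)).
Variable eps : R.
Implicit Types (m : reg -> R) (w s : nat).

Local Notation n := (n1 + n2)%N.
Local Notation X := (svm_index d n1 n2).
Local Notation wp := (@wp R reg X (svm_input P Q eps)).
Local Notation value := (value (svm_input P Q eps)).
Local Notation D := (max_norm P Q).
Local Notation sc := (@sc X).
Local Notation arr := (@arr X).
Local Notation num k := (Cst reg X k).

Hypotheses (d_gt0 : (0 < d)%N) (n1_gt0 : (0 < n1)%N) (n2_gt0 : (0 < n2)%N).

Let n_gt0 : (0 < n)%N. Proof. by rewrite addn_gt0 n1_gt0. Qed.

Lemma entry_value m i j : op_value (value m) (entry d n1 n2 i j) = augmented P Q i j.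
Proof.
rewrite /entry /augmented; case: insubP => [i' _ _|_] /=; last by rewrite addr0.
case: insubP => [j' _ _|_] /=; first by rewrite addr0.
by case: insubP => [j' _ _|_] /=; rewrite ?sub0r ?addr0.
Qed.

Lemma entry_defined m i j : op_defined (value m) (entry d n1 n2 i j).
Proof. by rewrite /entry; do 2?[case: insubP => // *]; case: insubP. Qed.

Lemma entry_reads i j : reads (entry d n1 n2 i j : operation (operand reg X)) = [::].
Proof. by rewrite /entry; do 2?[case: insubP => // *]; case: insubP. Qed.

Definition loaded m : Prop := forall i j, (i < d.+2)%N -> (j < n)%N ->
  m (rA, i, j) = augmented P Q i j.

Definition weigh_work : nat := (2 * n + sums_work d.+2 n)%N.
Definition weigh_span : nat := (2 + sums_span n)%N.

Lemma wp_weigh m w s K : loaded m ->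
    (forall m', 
       (forall j, (j < n)%N ->
          m' (rP, 0, j)%N = expR (m (rS, 0, j)%N * m (rK, 0, 0)%N)) ->
       (forall i, (i < d.+2)%N ->
          m' (rG, 0, i)%N = aug_mul P Q (fun j => m' (rP, 0, j)%N) i) ->
       frame [:: rX; rR; rP; rG] m m' ->
       forall w', (w' <= w + weigh_work)%N -> K m' w' (s + weigh_span)%N) ->
  wp (weigh d n1 n2) K m w s.
Proof.
move=> m_A Km; apply: wp_seq; apply: wp_vec => // m1 m1E _ m1F.
apply: wp_seq; apply: wp_vec => // m2 m2E _ m2F.
apply: wp_sums => // m3 m3E m3F w' w'_le.
have -> : (s.+2 + sums_span n = s + weigh_span)%N by rewrite /weigh_span; lia.
apply: Km.
- by move=> j jn; rewrite m3F // m2E //= m1E.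
- move=> i ie; rewrite m3E // /aug_mul; apply: eq_bigr => j _ /=.
  by rewrite m2F // m1F // m_A ?ltn_ord // m3F.
- by case=> // i j _; rewrite m3F // m2F // m1F.
- by apply: (leq_trans w'_le); rewrite /weigh_work; lia.
Qed.

Definition direct_work : nat := (sums_work 1 d + d + 11)%N.
Definition direct_span : nat := (sums_span d + 12)%N.

Lemma wp_direct m w s K : let g i := m (rG, 0, i)%N in
    (forall m',
       (forall i, (i < d)%N -> m' (rW, 0, i)%N =
          g i / (Num.sqrt (\sum_(i < d) g i * g i) + 1
                 - (if 0 < Num.sqrt (\sum_(i < d) g i * g i) then 1 else 0))) ->
       m' (rW, 0, d)%N = (if g d.+1 < g d then 1 else 0)
          * (2 * m (rD, 0, 0)%N - m (rAlpha, 0, 0)%N) - m (rD, 0, 0)%N ->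
       m' (rW, 0, d.+1)%N = - (m' (rW, 0, d)%N + m (rAlpha, 0, 0)%N) ->
       frame [:: rX; rN; r1; r2; rW] m m' ->
       forall w', (w' <= w + direct_work)%N -> K m' w' (s + direct_span)%N) ->
  wp (direct d n1 n2) K m w s.
Proof.
move=> g Km; apply: wp_seq; apply: wp_sums => // m1 m1E m1F w1 w1_le.
have {m1E}m1E : m1 (rN, 0, 0)%N = \sum_(i < d) g i * g i by exact: m1E.
have N_ge0 : 0 <= m1 (rN, 0, 0)%N.
  by rewrite m1E; apply: sumr_ge0 => i _; rewrite -expr2 sqr_ge0.
do 4!(apply: wp_seq; apply: wp_assign => //).
set m2 := upd _ _ _.
have m2N : m2 (rN, 0, 0)%N = Num.sqrt (\sum_(i < d) g i * g i) + 1
    - (if 0 < Num.sqrt (\sum_(i < d) g i * g i) then 1 else 0).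
  by rewrite /m2 /upd /= -m1E.
have m2F : frame [:: rX; rN; r1] m m2.
  by case=> // i j _; rewrite /m2 /upd /= m1F.
clearbody m2; apply: wp_seq; apply: wp_vec => // [i j _ _|m3 m3E _ m3F].
  rewrite /= m2N; have := sqrtr_ge0 (\sum_(i < d) g i * g i).
  rewrite le_eqVlt => /predU1P[<-|N_gt0]; first by rewrite ltxx add0r subr0 oner_eq0.
  by rewrite N_gt0 addrK gt_eqF.
do 6!(apply: wp_seq; apply: wp_assign => //); apply: wp_assign => //.
set m4 := upd _ _ _.
have -> : (s + sums_span d).+4.+4.+4 = (s + direct_span)%N by rewrite /direct_span; lia.
have d_neq : (d.+1 == d) = false by lia.
have d_neq' : (d == d.+1) = false by lia.
apply: Km; rewrite /m4 /upd /= ?xpair_eqE /= ?eqxx ?d_neq ?d_neq' /=.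
- move=> i id; rewrite !xpair_eqE /= (ltn_eqF id) (ltn_eqF (leqW id)) /=.
  by rewrite m3E //= m2N m2F.
- by rewrite !m3F // !m2F // -/g; congr (_ * _ - _); ring.
- by rewrite !m3F // !m2F // sub0r.
- by case=> // i j _; rewrite /= m3F // m2F.
- by rewrite /direct_work; lia.
Qed.

End Blocks.

(** * Runs of the feasibility test *)

Section Runs.
Variables (R : realType) (d n1 n2 : nat) (P : 'M[R]_(d, n1)) (Q : 'M[R]_(d, n2)).
Implicit Types (x : nat -> svm_point R d) (p w : nat -> R).

Local Notation n := (n1 + n2)%N.

Lemma eq_pd_of p p' : (forall j, (j < n)%N -> p j = p' j) ->
  pd_of n1 n2 p = pd_of n1 n2 p'.
Proof.
move=> pp'; congr PdPoint; apply/colP => j; rewrite !mxE pp' //.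
  by rewrite (leq_trans (ltn_ord j)) // leq_addr.
by rewrite ltn_add2l ltn_ord.
Qed.

(** A run is a prefix of an infinite sequence of oracle solutions, prolonged by overwriting the next
    entry. *)
Definition extend x t z : nat -> svm_point R d := fun i => if i == t then z else x i.

Lemma sum_extend (V : zmodType) (F : svm_point R d -> V) x t z :
  \sum_(1 <= i < t.+2) F (extend x t.+1 z i) = \sum_(1 <= i < t.+1) F (x i) + F z.
Proof.
rewrite big_nat_recr //= {2}/extend eqxx; congr (_ + _).
by rewrite !big_nat; apply: eq_bigr => i /andP[_ it]; rewrite /extend (ltn_eqF it).
Qed.

Lemma weights_extend rho eta x t t' z : (t <= t')%N ->
  weights P Q rho eta (extend x t' z) t = weights P Q rho eta x t.
Proof.
move=> tt'; rewrite /weights; case: (leqP t 1%N) => [//|t_gt1].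
rewrite /exp_weights; have -> // : average (extend x t' z) t.-1 = average x t.-1.
have ext_sum (V : zmodType) (F : svm_point R d -> V) :
    \sum_(1 <= i < t.-1.+1) F (extend x t' z i) = \sum_(1 <= i < t.-1.+1) F (x i).
  rewrite !big_nat; apply: eq_bigr => i /andP[_ it]; rewrite /extend ltn_eqF //.
  by apply: leq_trans it _; rewrite prednK // ltnW.
by rewrite /average !ext_sum.
Qed.

Lemma test_run_extend alpha eps' x t z :
  test_run P Q alpha eps' x t -> test_run P Q alpha eps' (extend x t.+1 z) t.
Proof.
move=> run i /andP[i_gt0 it]; rewrite /test_weights weights_extend; last exact: leqW.
by rewrite /extend ltn_eqF //; apply: run; rewrite i_gt0.
Qed.

Lemma test_run_extendS alpha eps' x t z : test_run P Q alpha eps' x t ->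
    oracle_optimal P Q alpha (test_weights P Q alpha eps' x t.+1) z ->
    0 <= oracle_value P Q (test_weights P Q alpha eps' x t.+1) z ->
  test_run P Q alpha eps' (extend x t.+1 z) t.+1.
Proof.
move=> run z_opt z_val i /andP[i_gt0 it].
move: it; rewrite leq_eqVlt => /predU1P[->|it].
  by rewrite /test_weights weights_extend // /extend eqxx.
by apply: test_run_extend => //; rewrite i_gt0.
Qed.

Lemma oracle_optimal_scale alpha (c : R) (q : pd_point R n1 n2) z : 0 < c ->
  oracle_optimal P Q alpha q z ->
  oracle_optimal P Q alpha (PdPoint (c *: muw q) (c *: gamw q)) z.
Proof.
move=> c_gt0 [z_feas z_opt]; split=> // z' /z_opt.
by rewrite !oracle_value_scale ler_pM2l.
Qed.

Lemma weights_pd_of rho eta x t p : (0 < n1)%N ->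
    (forall j : 'I_n,
       p j = expR (- (eta / rho) * \sum_(1 <= i < t.+1) slack P Q (x i) j 0)) ->
  exists2 c : R, 0 < c & weights P Q rho eta x t.+1
    = PdPoint (c *: muw (pd_of n1 n2 p)) (c *: gamw (pd_of n1 n2 p)).
Proof.
move=> n1_gt0 pE; have [c c_gt0 wE] := weights_exp P Q rho eta x t n1_gt0.
by exists c => //; apply: scale_wvec => j; rewrite wvec_pd_of pE.
Qed.

End Runs.

(** * Verification of the feasibility test *)

Section Verification.
Variables (R : realType) (d n1 n2 : nat) (P : 'M[R]_(d, n1)) (Q : 'M[R]_(d, n2)).
Variable eps : R.
Implicit Types (m : reg -> R) (w s t : nat).

Local Notation n := (n1 + n2)%N.
Local Notation X := (svm_index d n1 n2).
Local Notation wp := (@wp R reg X (svm_input P Q eps)).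
Local Notation value := (value (svm_input P Q eps)).
Local Notation D := (max_norm P Q).
Local Notation svm_of := (@svm_of R d).
Local Notation pd_of := (@pd_of R n1 n2).
Local Notation loaded := (loaded P Q).

Hypotheses (d_gt0 : (0 < d)%N) (n1_gt0 : (0 < n1)%N) (n2_gt0 : (0 < n2)%N).
Hypothesis D_gt0 : 0 < D.

Let n_gt0 : (0 < n)%N. Proof. by rewrite addn_gt0 n1_gt0. Qed.

Section Test.
Variables alpha eps' : R.
Hypotheses (alpha_gt0 : 0 < alpha) (alpha_le : alpha <= 2 * D).

Let T := test_T P Q alpha eps'.

(** The oracle solutions [x] are ghost data: the registers keep only sums over them, and the
    averages are formed at the end of the test. *)
Definition running m t : Prop := exists x : nat -> svm_point R d,
  [/\ test_run P Q alpha eps' x t,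
      forall j : 'I_n, m (rS, 0, val j)%N = \sum_(1 <= i < t.+1) slack P Q (x i) j 0
    & svm_of (fun i => m (rV, 0, i)%N)
      = SvmPoint (\sum_(1 <= i < t.+1) dir (x i)) (\sum_(1 <= i < t.+1) off1 (x i))
                 (\sum_(1 <= i < t.+1) off2 (x i))].

(** Besides the outcome of the test, this keeps what [conclude] divides by: the sums of the weights
    in [rG], positive since the weights are. *)
Definition below m : Prop := let p j := m (rP, 0, j)%N in
  [/\ test_below P Q alpha eps' (normalize (pd_of p)),
      forall i, (i < d.+2)%N -> m (rG, 0, i)%N = aug_mul P Q p i
    & forall j, (j < n)%N -> 0 < p j].

Definition iteration_work : nat :=
  (weigh_work d n1 n2 + direct_work d + sums_work 1 d.+2 + sums_work n d.+2
   + n + d + 6)%N.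

Definition iteration_span : nat :=
  (weigh_span n1 n2 + direct_span d + 2 * sums_span d.+2 + 4)%N.

Definition iteration_banks : seq bank :=
  [:: rX; rR; rP; rG; rN; r1; r2; rW; rVal; rLow; rt; rS; rV].

Definition ready m : Prop :=
  [/\ loaded m, m (rD, 0, 0)%N = D, m (rAlpha, 0, 0)%N = alpha, m (rT, 0, 0)%N = T%:R
    & m (rK, 0, 0)%N = - (test_eta P Q alpha eps' / test_rho P Q)].

Definition ongoing m t : Prop :=
  [/\ m (rt, 0, 0)%N = t%:R, m (rLow, 0, 0)%N = 0 & running m t].

Definition stopped m : Prop :=
  [/\ m (rt, 0, 0)%N = T%:R, m (rLow, 0, 0)%N = 1 & below m].

Lemma wp_iteration m w s t K : ready m -> (t < T)%N -> ongoing m t ->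
    (forall m' w' s', frame iteration_banks m m' ->
       ongoing m' t.+1 \/ stopped m' ->
       (w' <= w + iteration_work)%N -> (s' <= s + iteration_span)%N -> K m' w' s') ->
  wp (iteration d n1 n2) K m w s.
Proof.
move=> [m_A mD malpha mT mK] tT [mt mLow [x [run mS mV]]] Km.
apply: wp_seq; apply: wp_weigh => // m1 m1P m1G m1F w1 w1_le.
apply: wp_seq; apply: wp_direct => // m2 m2W m2d m2d1 m2F w2 w2_le.
apply: wp_seq; apply: wp_sums => // m3 /(_ 0%N isT) m3Val m3F w3 w3_le.
pose p j := m1 (rP, 0, j)%N; pose z i := m2 (rW, 0, i)%N.
have p_gt0 j : (j < n)%N -> 0 < p j by move=> jn; rewrite /p m1P ?expR_gt0.
(* [oracle_optimal_of] asks for nonnegative weights at every index, but the bank [rP] is controlled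
   only below [n]. *)
pose p' j := if (j < n)%N then p j else 0.
have aug_p' i : aug_mul P Q p' i = aug_mul P Q p i.
  by apply: eq_bigr => j _; rewrite /p' ltn_ord.
have pd_p' : pd_of p' = pd_of p.
  by apply: eq_pd_of => j jn; rewrite /p' jn.
have z_opt : oracle_optimal P Q alpha (pd_of p) (svm_of z).
  rewrite -pd_p'; apply: oracle_optimal_of => //.
  - by move=> j; rewrite /p'; case: ifP => // /p_gt0 /ltW.
  - move=> i id; rewrite /z m2W // m1G ?aug_p'; last by lia.
    have -> // : \sum_(i < d) m1 (rG, 0, val i)%N * m1 (rG, 0, val i)%N
        = \sum_(i < d) aug_mul P Q p' i * aug_mul P Q p' i.
    by apply: eq_bigr => k _; rewrite /= aug_p' m1G //; exact/leqW/leqW/ltn_ord.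
  - by rewrite /z m2d !aug_p' !m1G ?m1F ?mD ?malpha //.
  - by rewrite /z m2d1 m1F // malpha.
have val_z : m3 (rVal, 0, 0)%N = oracle_value P Q (pd_of p) (svm_of z).
  rewrite m3Val oracle_value_of; apply: eq_bigr => i _ /=.
  by rewrite m2F // m1G.
have pE (j : 'I_n) : p j = expR (- (test_eta P Q alpha eps' / test_rho P Q)
    * \sum_(1 <= i < t.+1) slack P Q (x i) j 0).
  by rewrite /p m1P // mS mK mulrC.
have [c c_gt0 wE] := weights_pd_of n1_gt0 pE.
have w_opt : oracle_optimal P Q alpha (test_weights P Q alpha eps' x t.+1) (svm_of z).
  by rewrite /test_weights wE; exact: oracle_optimal_scale.
have w_val : oracle_value P Q (test_weights P Q alpha eps' x t.+1) (svm_of z)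
    = c * oracle_value P Q (pd_of p) (svm_of z).
  by rewrite /test_weights wE oracle_value_scale.
apply: wp_if => /=; rewrite val_z => z_val.
  apply: wp_seq; do 2!apply: wp_assign => //; apply: Km.
  - by case=> // i j _; rewrite /upd /= m3F // m2F // m1F.
  - right; split; rewrite /upd /= ?addr0 //.
      by rewrite m3F // m2F // m1F.
    have pP : (fun j => m3 (rP, 0, j)%N) = p by apply/funext => j; rewrite m3F // m2F.
    split=> /=.
    + rewrite pP; exists (extend x t.+1 (svm_of z)), t.+1.
      rewrite /test_weights weights_extend // /extend eqxx; split=> //.
      * exact: test_run_extend.
      * by rewrite w_val pmulr_rlt0.
      * by rewrite wE normalize_scale // gt_eqF.
    + by move=> i ie; rewrite pP m3F // m2F // m1G.
    + by move=> j jn; have := p_gt0 j jn; rewrite -pP.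
  - by rewrite /iteration_work; lia.
  - by rewrite /iteration_span; lia.
apply: wp_seq; apply: wp_sums => // m4 m4R m4F w4 w4_le.
apply: wp_seq; apply: wp_vec => // [i j i' j'|m5 m5S _ m5F].
  by rewrite !inE !xpair_eqE /= ltnS leqn0 => /eqP-> _ _ _ /orP[]// /andP[/eqP-> /eqP->].
apply: wp_seq; apply: wp_vec => // [i j i' j'|m6 m6V _ m6F].
  by rewrite !inE !xpair_eqE /= ltnS leqn0 => /eqP-> _ _ _ /orP[]// /andP[/eqP-> /eqP->].
apply: wp_assign => //; set m7 := upd _ _ _; apply: Km.
- by case=> // i j _; rewrite /m7 /upd /= m6F // m5F // m4F // m3F // m2F // m1F.
- left; split; rewrite ?/m7 /upd /=.
  + by rewrite m6F // m5F // m4F // m3F // m2F // m1F // mt natr1.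
  + by rewrite m6F // m5F // m4F // m3F // m2F // m1F.
  exists (extend x t.+1 (svm_of z)); split.
  + by apply: test_run_extendS => //; rewrite w_val pmulr_rge0.
  + move=> j; rewrite (sum_extend (fun y => slack P Q y j 0)) slack_svm_of.
    rewrite /m7 /upd /= m6F // m5S //= m4R //= m4F // m3F // m2F // m1F // mS.
    congr (_ + _); apply: eq_bigr => i _; rewrite /= !m3F // m2F // m1F // m_A //.
  + rewrite !sum_extend; case: mV => [mdir moff1 moff2].
    have mVE i : (i < d.+2)%N -> m7 (rV, 0, i)%N = m (rV, 0, i)%N + z i.
      move=> ie; rewrite /m7 /upd /= m6V //= m5F // m4F // m3F // m2F // m1F //.
      by rewrite m5F // m4F // m3F.
    congr SvmPoint.
    * by apply/colP => i; rewrite -mdir !mxE; apply: mVE; exact/leqW/leqW/ltn_ord.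
    * by rewrite -moff1 /= -opprD; congr (- _); exact: mVE.
    * by rewrite -moff2 /= -opprD; congr (- _); exact: mVE.
- by rewrite /iteration_work; lia.
- by rewrite /iteration_span; lia.
Qed.
Lemma frame_ready m m' : frame iteration_banks m m' -> ready m -> ready m'.
Proof.
move=> mF [m_A ? ? ? ?]; split; rewrite ?mF // => i j ie jn.
by rewrite mF // m_A.
Qed.

Lemma wp_test_loop m w s K : ready m -> ongoing m 0 ->
    (forall m' w' s', frame iteration_banks m m' ->
       ongoing m' T \/ stopped m' ->
       (w' <= w + (T * iteration_work.+1).+1)%N ->
       (s' <= s + (T * iteration_span.+1).+1)%N -> K m' w' s') ->
  wp (While (sc X rt) (sc X rT) (iteration d n1 n2)) K m w s.
Proof.
move=> m_ready m_start Km.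
(* Here [t] counts the executed iterations for the costs. Once the test has stopped, the next guard
   fails, so nothing is asked of the variant [k]. *)
pose I k m' w' s' := frame iteration_banks m m' /\
  exists t, [/\ (t <= T)%N, (w' <= w + t * iteration_work.+1)%N,
    (s' <= s + t * iteration_span.+1)%N & ongoing m' t /\ k = (T - t)%N \/ stopped m'].
apply: (@wp_while _ _ _ _ I) => [k m' w' s' [m'F [t [tT w'_le s'_le m't]]]||].
- have m'_ready := frame_ready m'F m_ready; have [_ _ _ m'T _] := m'_ready.
  case: m't => [[m't kE]|[m't _ _]] /=; last by rewrite m't m'T ltxx.
  have [m'rt _ _] := m't; rewrite m'rt m'T ltr_nat => t_lt.
  apply: wp_iteration m't _ => // m2 w2 s2 m2F m2t w2_le s2_le.
  exists (T - t.+1)%N; first by rewrite kE; lia.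
  split; first by move=> b i j bF; rewrite m2F // m'F.
  exists t.+1; split=> //; [lia|lia|].
  by case: m2t => [m2t|?]; [left|right].
- move=> k m' w' s' [m'F [t [tT w'_le s'_le m't]]] /= T_le; apply: Km => //.
  + case: m't => [[m't _]|m't]; [left|by right].
    have [_ _ _ m'T _] := frame_ready m'F m_ready.
    have [m'rt _ _] := m't; move: T_le; rewrite m'rt m'T ler_nat => T_le.
    by have -> : T = t by apply/eqP; rewrite eqn_leq T_le.
  + by nia.
  + by nia.
- by split=> //; exists 0%N; split=> //; [lia|lia|left; rewrite subn0].
Qed.

End Test.

End Verification.

(** * Verification of the search *)

Section Search.
Variables (R : realType) (d n1 n2 : nat) (P : 'M[R]_(d, n1)) (Q : 'M[R]_(d, n2)).
Variable eps : R.
Implicit Types (m : reg -> R) (w s t : nat).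

Local Notation n := (n1 + n2)%N.
Local Notation X := (svm_index d n1 n2).
Local Notation wp := (@wp R reg X (svm_input P Q eps)).
Local Notation D := (max_norm P Q).
Local Notation pd_of := (@pd_of R n1 n2).
Local Notation loaded := (loaded P Q).
Local Notation ln_n := (ln n%:R : R).

Hypotheses (d_gt0 : (0 < d)%N) (n1_gt0 : (0 < n1)%N) (n2_gt0 : (0 < n2)%N).
Hypothesis D_gt0 : 0 < D.

(** A natural number is below the ceiling of a real exactly when it is below the real itself; hence
    the counting loop stops at T. *)
Lemma test_T_count (alpha eps' : R) k : (k < test_T P Q alpha eps')%N
  = (k%:R < 4 * 2 ^+ 2 * test_rho P Q ^+ 2 * ln_n / (eps' ^+ 2 * alpha ^+ 2)).
Proof.
rewrite /test_T; set b := _ / _; have b_ge0 : 0 <= b.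
  have ln_ge0 : 0 <= ln_n by exact/ltW/ln_size_gt0.
  by rewrite divr_ge0 // mulr_ge0 ?sqr_ge0 // mulr_ge0 ?sqr_ge0 // mulr_ge0 ?sqr_ge0.
have ceil_b : (0 <= Num.ceil b)%R by rewrite ceil_ge0 (lt_le_trans _ b_ge0) // ltrN10.
rewrite -(ltr_nat R) natr_absz ger0_norm // -[k%:R]/(k%:~R) ltr_int.
by rewrite ceil_gt_int.
Qed.

Lemma wp_prepare m w s K : m (rL, 0, 0)%N < m (rU, 0, 0)%N ->
    let tol := (m (rU, 0, 0)%N - m (rL, 0, 0)%N) / 3 in
    (forall m',
       m' (rTol, 0, 0)%N = tol ->
       m' (rAlpha, 0, 0)%N = m (rU, 0, 0)%N - tol ->
       m' (rBound, 0, 0)%N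
         = m (rD, 0, 0)%N * m (rD, 0, 0)%N * 64 * ln_n / (tol * tol) ->
       m' (rT, 0, 0)%N = 0 ->
       frame [:: rTol; rAlpha; r1; r2; rBound; rT] m m' -> K m' (w + 9)%N (s + 9)%N) ->
  wp (prepare d n1 n2) K m w s.
Proof.
move=> LU tol Km; apply: wp_seq; apply: wp_assign => //.
apply: wp_seq; apply: wp_assign; first by rewrite /= pnatr_eq0.
do 5!(apply: wp_seq; apply: wp_assign => //).
apply: wp_seq; apply: wp_assign.
  have tol_neq0 : tol != 0 by rewrite mulf_neq0 ?invr_eq0 ?pnatr_eq0 // subr_eq0 gt_eqF.
  exact: (mulf_neq0 tol_neq0 tol_neq0).
apply: wp_assign => //; set m' := upd _ _ _.
have := Km m'; rewrite !addnS !addn0; apply; rewrite ?/m' /upd //=.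
  by rewrite addr0.
by case.
Qed.

Lemma wp_count_rounds m w s T K :
    (forall k, (k < T)%N = (k%:R < m (rBound, 0, 0)%N)) -> m (rT, 0, 0)%N = 0 ->
    (forall m', m' (rT, 0, 0)%N = T%:R -> frame [:: rT] m m' ->
       K m' (w + (2 * T).+1)%N (s + (2 * T).+1)%N) ->
  wp (count_rounds d n1 n2) K m w s.
Proof.
move=> T_lt mT Km.
pose I k m' w' s' := frame [:: rT] m m' /\ exists t,
  [/\ (t <= T)%N, k = (T - t)%N, m' (rT, 0, 0)%N = t%:R, w' = (w + 2 * t)%N
    & s' = (s + 2 * t)%N].
apply: (@wp_while _ _ _ _ I) => [k m' w' s' [m'F [t [tT -> m't -> ->]]]||].
- rewrite /= m't m'F // -T_lt => t_lt; apply: wp_assign => //.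
  exists (T - t.+1)%N; first by lia.
  split; first by case=> // i j _; rewrite /upd /= m'F.
  exists t.+1; split=> //; [|lia|lia].
  by rewrite /upd /= m't natr1.
- move=> k m' w' s' [m'F [t [tT _ m't -> ->]]] /=.
  rewrite m't m'F // leNgt -T_lt -leqNgt => T_le.
  have tE : t = T by apply/eqP; rewrite eqn_leq tT.
  have := Km m'; rewrite !addnS tE; apply=> //; by rewrite m't tE.
- by split=> //; exists 0%N; rewrite muln0 !addn0.
Qed.

Lemma wp_rescale m w s (T : nat) K : (0 < T)%N -> m (rT, 0, 0)%N = T%:R ->
    m (rD, 0, 0)%N = D ->
    (forall m', m' (rK, 0, 0)%N = - (Num.sqrt (ln_n / T%:R) / (2 * D)) ->
       m' (rLow, 0, 0)%N = 0 -> m' (rt, 0, 0)%N = 0 ->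
       (forall j, (j < n)%N -> m' (rS, 0, j)%N = 0) ->
       (forall i, (i < d.+2)%N -> m' (rV, 0, i)%N = 0) ->
       frame [:: rK; r1; rLow; rt; rS; rV] m m' ->
       K m' (w + n + d + 9)%N (s + 9)%N) ->
  wp (rescale d n1 n2) K m w s.
Proof.
move=> T_gt0 mT mD Km; have ln_gt0 := ln_size_gt0 R n1_gt0 n2_gt0.
apply: wp_seq; apply: wp_assign; first by rewrite /= mT pnatr_eq0 -lt0n.
apply: wp_seq; apply: wp_assign.
  by rewrite /upd /= mT divr_ge0 // ltW.
apply: wp_seq; apply: wp_assign => //.
apply: wp_seq; apply: wp_assign.
  by rewrite /upd /= mD gt_eqF // addr_gt0.
do 3!(apply: wp_seq; apply: wp_assign => //).
apply: wp_seq; apply: wp_vec => // m1 m1S _ m1F; apply: wp_vec => // m2 m2V _ m2F.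
have -> : (w.+4.+3 + 1 * n + 1 * d.+2 = w + n + d + 9)%N by lia.
have -> : s.+4.+4.+1 = (s + 9)%N by lia.
apply: Km.
- by rewrite m2F // m1F // /upd /= mT mD sub0r mulr2n mulrDl mul1r.
- by rewrite m2F // m1F // /upd /= addr0.
- by rewrite m2F // m1F // /upd /= addr0.
- by move=> j jn; rewrite m2F // m1S //= addr0.
- by move=> i ie; rewrite m2V //= addr0.
- by case=> // i j _; rewrite m2F // m1F.
Qed.

Definition svm_out m : svm_point R d :=
  SvmPoint (\col_(i < d) m (rO, 0, val i)%N) (m (rO, 0, d)%N) (m (rO, 0, d.+1)%N).

Definition pd_out m : pd_point R n1 n2 := pd_of (fun j => m (rQ, 0, j)%N).

Lemma wp_conclude_low m w s K : m (rLow, 0, 0)%N = 1 ->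
    let p j := m (rP, 0, j)%N in
    (forall i, (i < d.+2)%N -> m (rG, 0, i)%N = aug_mul P Q p i) ->
    (forall j, (j < n)%N -> 0 < p j) ->
    (forall m', m' (rU, 0, 0)%N = m (rAlpha, 0, 0)%N ->
       pd_out m' = normalize (pd_of p) -> frame [:: rU; rQ] m m' ->
       K m' (w + n + 2)%N (s + 3)%N) ->
  wp (conclude d n1 n2) K m w s.
Proof.
move=> mLow p mG p_gt0 Km; apply: wp_if => /=; rewrite mLow; last first.
  by rewrite leNgt ltr01.
move=> _; apply: wp_seq; apply: wp_assign => //.
have mu_gt0 : 0 < aug_mul P Q p d.
  have pmu_gt0 (j : 'I_n1) : 0 < p j by rewrite p_gt0 // ltn_addr.
  rewrite aug_mul_mu /entry_sum (bigD1 (Ordinal n1_gt0)) //= mxE ltr_wpDr ?pmu_gt0 //.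
    by apply: sumr_ge0 => j _; rewrite mxE ltW.
have gam_gt0 : 0 < aug_mul P Q p d.+1.
  have pgam_gt0 (j : 'I_n2) : 0 < p (n1 + j)%N by rewrite p_gt0 // ltn_add2l.
  rewrite aug_mul_gam /entry_sum (bigD1 (Ordinal n2_gt0)) //= mxE ltr_wpDr //.
    by apply: sumr_ge0 => j _; rewrite mxE ltW.
apply: wp_vec => // [i j _ jn|m' m'Q _ m'F].
  by rewrite /upd /=; case: ifP => _; rewrite mG // gt_eqF.
have -> : (w.+2 + 1 * n = w + n + 2)%N by lia.
rewrite -[s.+3]addn3; apply: Km.
- by rewrite m'F // /upd /= addr0.
- rewrite /pd_out /normalize -(aug_mul_mu P Q) -(aug_mul_gam P Q).
  congr PdPoint; apply/colP => j; rewrite !mxE m'Q //= ?/upd /=.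
  + by rewrite ltn_ord mG // mulrC.
  + by rewrite (leq_trans (ltn_ord j)) // leq_addr.
  + by rewrite ltnNge leq_addr /= mG // mulrC.
  + by rewrite ltn_add2l.
- by case=> // i j _; rewrite m'F.
Qed.

Lemma wp_conclude_high m w s (T : nat) K : m (rLow, 0, 0)%N = 0 ->
    m (rT, 0, 0)%N = T%:R -> (0 < T)%N ->
    let v i := T%:R^-1 * m (rV, 0, i)%N in
    let tol := m (rTol, 0, 0)%N in
    (forall m', m' (rL, 0, 0)%N = m (rAlpha, 0, 0)%N - tol ->
       svm_out m' = SvmPoint (\col_(i < d) v i) (- v d - tol / 2) (- v d.+1 - tol / 2) ->
       frame [:: rL; r1; rO] m m' -> K m' (w + d + 9)%N (s + 8)%N) ->
  wp (conclude d n1 n2) K m w s.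
Proof.
move=> mLow mT T_gt0 v tol Km; apply: wp_if => /=; rewrite mLow; first by rewrite ltxx.
have T_neq0 : T%:R != 0 :> R by rewrite pnatr_eq0 -lt0n.
move=> _; apply: wp_seq; apply: wp_assign => //.
apply: wp_seq; apply: wp_assign; first by rewrite /= pnatr_eq0.
apply: wp_seq; apply: wp_vec => // [i j _ _|m1 m1O _ m1F].
  by rewrite /upd /= mT.
do 3!(apply: wp_seq; apply: wp_assign => //); apply: wp_assign => //.
set m' := upd _ _ _; have d_neq : (d.+1 == d) = false by lia.
have d_neq' : (d == d.+1) = false by lia.
have -> : (w.+3 + 1 * d.+2).+4 = (w + d + 9)%N by lia.
have -> : s.+4.+4 = (s + 8)%N by lia.
apply: Km.
- by rewrite /m' /upd /= m1F.
- rewrite /svm_out /m'; congr SvmPoint.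
  + apply/colP => i; rewrite !mxE /upd /= !xpair_eqE /= (ltn_eqF (ltn_ord i)).
    rewrite (ltn_eqF (leqW (ltn_ord i))) m1O //= ?/upd /= ?mT 1?mulrC //.
    exact/leqW/leqW/ltn_ord.
  + rewrite /upd /= !xpair_eqE /= ?eqxx ?d_neq ?d_neq' /= m1O //= m1F // /upd /= mT.
    by rewrite sub0r opprD mulrC.
  + rewrite /upd /= !xpair_eqE /= ?eqxx ?d_neq ?d_neq' /= m1O //= m1F // /upd /= mT.
    by rewrite sub0r opprD mulrC.
- by case=> // i j _; rewrite /m' /upd /= m1F.
Qed.

End Search.

(** * Numerical estimates for the cost of the search *)

(** From exp(- 1/2) >= 1/2 one gets exp(1/2) <= 2 <= k. The bound lets logarithms absorb additive
    constants. *)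
Lemma half_le_ln (R : realType) (k : nat) : (1 < k)%N -> 1 / 2 <= ln k%:R :> R.
Proof.
move=> k_gt1; have k_gt0 : 0 < k%:R :> R by rewrite ltr0n ltnW.
rewrite -ler_expR lnK //; apply: (@le_trans _ _ 2); last by rewrite ler_nat.
have := expR_ge1Dx (- (1 / 2) : R); rewrite expRN.
have := expR_gt0 (1 / 2 : R); set e := expR _ => e_gt0.
by move=> /(ler_wpM2r (ltW e_gt0)); rewrite mulVf ?gt_eqF //; lra.
Qed.

(** The guard of the search loop costs one per round and is charged to the T > 0 iterations of the
    round, which raises their price from [c] to [c.+1]. *)
Lemma chain_cost (N T c w w' w'' : nat) : (0 < T)%N ->
  (w' <= w + N * c.+1)%N -> (w'' <= w'.+1 + T * c)%N ->
  (w'' <= w + (N + T) * c.+1)%N.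
Proof. by rewrite mulnDl [(T * _.+1)%N]mulnS; lia. Qed.

(** The factor is [N.+1] because the cost [i] of the initialization and the last guard are due even
    when N = 0. *)
Lemma total_cost (N c i w w' : nat) : (w <= i)%N -> (w' <= w + (N * c.+1).+1)%N ->
  (w' <= N.+1 * (c + i + 2))%N.
Proof.
move=> wi /leq_trans; apply; have := leq_pmull i (ltn0Sn N).
by rewrite !mulnDr mulnS !mulSn; lia.
Qed.

(** If the search goes on, eps OPT <= eps U = eps L + eps (U - L) < 2 (U - L), so even the next gap,
    two thirds of the present one, exceeds eps OPT / 3. *)
Lemma gap_lower (R : realType) (eps OPT L U : R) : 0 < eps -> eps <= 1 ->
  L < U -> OPT <= U -> eps * L < U - L -> eps * OPT / 3 < 2 / 3 * (U - L).
Proof.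
move=> eps_gt0 eps_le1 LU OU gap_gt.
have : eps * OPT <= eps * U by rewrite ler_pM2l.
have : eps * (U - L) <= 1 * (U - L) by rewrite ler_pM2r // subr_gt0.
lra.
Qed.

(** The growth factor 9/4 = (3/2)^2 of the potential [y] exceeds 2, so it covers both the [u] of the
    past and the [v] new iterations. *)
Lemma potential_step (R : realType) (y u v : R) : 0 <= u -> u <= y -> v <= y ->
  u + v <= 9 / 4 * y.
Proof. lra. Qed.

Lemma gap_start (R : realType) (eps OPT U : R) : 0 < OPT -> eps <= 1 -> OPT <= U ->
  eps * OPT / 3 < U.
Proof.
move=> OPT_gt0 eps_le1 OU; have : eps * OPT <= 1 * OPT by rewrite ler_pM2r.
lra.
Qed.

(** * Rounds of the search, the search loop and its initialization *)

Section Meta.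
Variables (R : realType) (d n1 n2 : nat) (P : 'M[R]_(d, n1)) (Q : 'M[R]_(d, n2)).
Variable eps : R.
Implicit Types (m : reg -> R) (w s t : nat) (K : (reg -> R) -> nat -> nat -> Prop).

Local Notation n := (n1 + n2)%N.
Local Notation X := (svm_index d n1 n2).
Local Notation wp := (@wp R reg X (svm_input P Q eps)).
Local Notation D := (max_norm P Q).
Local Notation loaded := (loaded P Q).
Local Notation svm_out := (svm_out d).
Local Notation pd_out := (pd_out n1 n2).
Local Notation ln_n := (ln n%:R : R).

Hypotheses (d_gt0 : (0 < d)%N) (n1_gt0 : (0 < n1)%N) (n2_gt0 : (0 < n2)%N).
Hypothesis D_gt0 : 0 < D.

Let n_gt1 : (1 < n)%N. Proof. by rewrite -(addn1 1) leq_add. Qed.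

Definition searching m (L U : R) : Prop :=
  [/\ loaded m, m (rD, 0, 0)%N = D, m (rL, 0, 0)%N = L, m (rU, 0, 0)%N = U
    & [/\ m (rGap, 0, 0)%N = U - L, m (rThr, 0, 0)%N = eps * L
        & search P Q L U (svm_out m) (pd_out m)]].

(* As gap <= 2 D, the quantity under the ceiling is at least 1, so that rounding at
   most doubles it. *)
Lemma test_T_le (alpha eps' gap : R) : 0 < gap -> gap <= 2 * D ->
    eps' * alpha = gap / 3 ->
  (test_T P Q alpha eps')%:R <= 1152 * D ^+ 2 * ln_n / gap ^+ 2.
Proof.
move=> gap_gt0 gap_le tolE; have ln_ge := half_le_ln R n_gt1.
have gap2_gt0 : 0 < gap ^+ 2 by exact: exprn_gt0.
(* 576 is 64 * 9, the tolerance being a third of the gap. *)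
set T := test_T _ _ _ _; pose b := 576 * D ^+ 2 * ln_n / gap ^+ 2.
have bE : 4 * 2 ^+ 2 * test_rho P Q ^+ 2 * ln_n / (eps' ^+ 2 * alpha ^+ 2) = b.
  by rewrite -exprMn tolE /test_rho /b; field; rewrite gt_eqF.
have b_ge1 : 1 <= b.
  rewrite ler_pdivlMr // mul1r; apply: (@le_trans _ _ ((2 * D) ^+ 2)).
    by rewrite lerXn2r ?nnegrE // ltW // mulr_gt0.
  have D2_gt0 : 0 < D ^+ 2 by exact: exprn_gt0.
  by rewrite exprMn; nra.
have -> : 1152 * D ^+ 2 * ln_n / gap ^+ 2 = b + b by rewrite /b; field; rewrite gt_eqF.
have [->|T_gt0] := posnP T; first by lra.
have : (T.-1 < T)%N by rewrite prednK.
rewrite test_T_count // bE -(ltrD2r 1) natr1 prednK //; lra.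
Qed.

Definition phase_work : nat := (iteration_work d n1 n2 + 2 * n + 2 * d + 40)%N.
Definition phase_span : nat := (iteration_span d n1 n2 + 40)%N.

(** 2 T pays for the counting loop and T [i.+1] for the iterations with their guards; the constant
    [c], due once, is charged to every iteration. *)
Lemma round_cost (T i c w w' : nat) : (0 < T)%N ->
  (w' <= w + 2 * T + T * i.+1 + c)%N -> (w' <= w + T * (i + 3 + c))%N.
Proof.
move=> T_gt0 /leq_trans; apply; have := leq_pmull c T_gt0.
rewrite -addnA -addnA leq_add2l (_ : i + 3 + c = i.+1 + 2 + c)%N; last by lia.
by rewrite !mulnDr (mulnC T 2); lia.
Qed.

Lemma phase_work_le (T w w' c : nat) : (0 < T)%N ->
    (w' <= w + 9 + (2 * T).+1 + n + d + 9 + (T * (iteration_work d n1 n2).+1).+1)%N ->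
    (c <= n + d + 15)%N ->
  (w' + c <= w + T * phase_work)%N.
Proof.
move=> T_gt0 w'_le c_le; rewrite /phase_work.
have -> : (iteration_work d n1 n2 + 2 * n + 2 * d + 40
   = iteration_work d n1 n2 + 3 + (2 * n + 2 * d + 37))%N by lia.
by apply: round_cost => //; lia.
Qed.

Lemma phase_span_le (T s s' c : nat) : (0 < T)%N ->
    (s' <= s + 9 + (2 * T).+1 + 9 + (T * (iteration_span d n1 n2).+1).+1)%N ->
    (c <= 10)%N ->
  (s' + c <= s + T * phase_span)%N.
Proof.
move=> T_gt0 s'_le c_le; rewrite /phase_span.
have -> : (iteration_span d n1 n2 + 40 = iteration_span d n1 n2 + 3 + 37)%N by lia.
by apply: round_cost => //; lia.
Qed.

Lemma wp_phase m w s L U K : searching m L U ->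
    (forall m' L' U' T w' s', searching m' L' U' -> U' - L' = 2 / 3 * (U - L) ->
       (0 < T)%N -> T%:R <= 1152 * D ^+ 2 * ln_n / (U - L) ^+ 2 ->
       (w' <= w + T * phase_work)%N -> (s' <= s + T * phase_span)%N -> K m' w' s') ->
  wp (phase d n1 n2) K m w s.
Proof.
move=> [m_A mD mL mU [_ _ m_search]] Km.
have [_ _ _ _ [L_ge0 LU U_le]] := search_correct n1_gt0 n2_gt0 D_gt0 m_search.
pose tol := (U - L) / 3; pose alpha := U - tol; pose eps' := tol / alpha.
have tol_gt0 : 0 < tol by rewrite /tol; lra.
have alpha_gt0 : 0 < alpha by rewrite /alpha /tol; lra.
have alpha_le : alpha <= 2 * D by apply: le_trans U_le; rewrite /alpha; lra.
have tolE : eps' * alpha = tol by rewrite /eps' divfK // gt_eqF.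
have tol_le : eps' * alpha <= 2 * D / 3.
  by rewrite tolE /tol; lra.
pose T := test_T P Q alpha eps'.
have T_gt0 : (0 < T)%N.
  by apply: test_T_gt0; rewrite ?tolE.
have T_le : T%:R <= 1152 * D ^+ 2 * ln_n / (U - L) ^+ 2.
  by apply: test_T_le; rewrite ?tolE //; lra.
have mid : middle_third L U alpha eps'.
  by split; rewrite ?mulrBl ?tolE /alpha /tol; lra.
apply: wp_seq; apply: wp_prepare; rewrite mL mU // -/tol -/alpha.
move=> k1 k1tol k1alpha k1bound k1T k1F.
apply: wp_seq; apply: (@wp_count_rounds _ _ _ _ _ _ _ _ _ _ _ _ _ _ T) => // [k|].
  rewrite test_T_count // k1bound mD; congr (_ < _).
  by rewrite -exprMn tolE /test_rho; field; rewrite gt_eqF.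
move=> k2 k2T k2F; apply: wp_seq; apply: (wp_rescale _ _ _ _ _ T_gt0) => //.
  by rewrite k2F // k1F.
move=> k3 k3K k3Low k3t k3S k3V k3F.
have k3_ready : ready P Q alpha eps' k3.
  split=> // [i j ie jn|||].
  - by rewrite k3F // k2F // k1F // m_A.
  - by rewrite k3F // k2F // k1F.
  - by rewrite k3F // k2F.
  - by rewrite k3F.
have k3_start : ongoing P Q alpha eps' k3 0.
  split=> //; exists (fun=> SvmPoint 0 0 0); split.
  - by case.
  - by move=> j; rewrite big_geq //; exact: k3S (ltn_ord j).
  - rewrite !big_geq // /svm_of !k3V // oppr0; congr SvmPoint.
    by apply/colP => i; rewrite !mxE k3V //; exact/leqW/leqW/ltn_ord.
apply: wp_seq.
apply: (wp_test_loop (eps' := eps') _ _ _ _ _ alpha_gt0) => // k4 w4 s4 k4F k4_end.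
move=> w4_le s4_le.
have k4_ready := frame_ready k4F k3_ready; have [k4A k4D k4alpha k4T _] := k4_ready.
have w_final c : (c <= n + d + 15)%N -> (w4 + c <= w + T * phase_work)%N.
  exact: phase_work_le T_gt0 w4_le.
have s_final c : (c <= 10)%N -> (s4 + c <= s + T * phase_span)%N.
  exact: phase_span_le T_gt0 s4_le.
have k4U : k4 (rU, 0, 0)%N = U by rewrite k4F // k3F // k2F // k1F.
have k4L : k4 (rL, 0, 0)%N = L by rewrite k4F // k3F // k2F // k1F.
have k4tol : k4 (rTol, 0, 0)%N = tol by rewrite k4F // k3F // k2F.
have k4O j : k4 (rO, 0, j)%N = m (rO, 0, j)%N by rewrite k4F // k3F // k2F // k1F.
have k4Q j : k4 (rQ, 0, j)%N = m (rQ, 0, j)%N by rewrite k4F // k3F // k2F // k1F.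
case: k4_end => [[k4t k4Low [x [run _ k4V]]]|[_ k4Low [k4_below k4G k4P]]].
- apply: wp_seq; apply: (wp_conclude_high _ _ _ _ _ k4Low k4T T_gt0) => //.
  move=> k5 k5L k5O k5F; apply: wp_seq; do 2!apply: wp_assign => //.
  have LE : (1 - eps') * alpha = alpha - tol by rewrite mulrBl mul1r tolE.
  apply: (Km _ (alpha - tol) U T) => //; last 2 first.
  + by rewrite -addn2 -addnA -addnA; apply: w_final; clear; lia.
  + by rewrite -addn2 -addnA; exact: s_final.
  + set k6 := upd _ _ _; split; rewrite /k6 /upd /=.
    * by move=> i j ie jn /=; rewrite k5F // k4A.
    * by rewrite k5F.
    * by rewrite k5L k4alpha k4tol.
    * by rewrite k5F.
    split=> //=; first by rewrite k5L k4alpha k4tol k5F // k4U.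
      by rewrite k5L k4alpha k4tol.
    rewrite -/(pd_out k6) -/(svm_out k6).
    have -> : pd_out k6 = pd_out m by apply: eq_pd_of => j _; rewrite /k6 /upd /= k5F.
    rewrite -LE; apply: SearchAbove m_search mid _; exists x; split=> //=.
    have -> : svm_out k6 = svm_out k5 by [].
    case: k4V => [k4dir k4off1 k4off2]; rewrite k5O tolE k4tol; congr SvmPoint.
    * by apply/colP => i; rewrite -k4dir !mxE.
    * by rewrite -k4off1 mulrN.
    * by rewrite -k4off2 mulrN.
  + by rewrite /alpha /tol; lra.
- apply: wp_seq; apply: (wp_conclude_low _ _ _ _ _ k4Low k4G k4P) => //.
  move=> k5 k5U k5Q k5F; apply: wp_seq; do 2!apply: wp_assign => //.
  set k6 := upd _ _ _; apply: (Km _ L alpha T) => //; last 2 first.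
  + by rewrite -addn2 -!addnA; apply: w_final; clear; lia.
  + by rewrite -addn2 -addnA; exact: s_final.
  + split; rewrite /k6 /upd /=.
    * by move=> i j ie jn /=; rewrite k5F // k4A.
    * by rewrite k5F.
    * by rewrite k5F.
    * by rewrite k5U.
    split=> //=; first by rewrite k5U k4alpha k5F // k4L.
      by rewrite k5F // k4L.
    have outE : svm_out k6 = svm_out m.
      have k6O j : k6 (rO, 0, j)%N = m (rO, 0, j)%N by rewrite /k6 /upd /= k5F.
      by congr SvmPoint => //; apply/colP => i; rewrite !mxE.
    by have := SearchBelow m_search mid k4_below; rewrite -k5Q -outE.
  + by rewrite /alpha /tol; lra.
Qed.

(* The potential 1152 D^2 ln n / gap^2 grows by a factor 9/4 at each round, which
   pays for its iterations; the last gap exceeds eps OPT / 3, whence 10368 = 9 * 1152. *)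
Lemma wp_search m w s (OPT : R) K :
    0 < OPT -> 0 < eps <= 1 -> svm_optimum P Q OPT -> pd_optimum P Q OPT ->
    searching m 0 (2 * D) ->
    (forall m' w' s' N, meta_algorithm P Q OPT eps (svm_out m') (pd_out m') ->
       N.+1%:R <= 10368 * (D ^+ 2 / OPT ^+ 2 * ln_n / eps ^+ 2) ->
       (w' <= w + (N * phase_work.+1).+1)%N -> (s' <= s + (N * phase_span.+1).+1)%N ->
       K m' w' s') ->
  wp (While (sc X rThr) (sc X rGap) (phase d n1 n2)) K m w s.
Proof.
move=> OPT_gt0 /andP[eps_gt0 eps_le1] [_ svm_ub] [_ pd_lb] m_start Km.
have ln_ge := half_le_ln R n_gt1.
pose a := 1152 * D ^+ 2 * ln_n; have a_gt0 : 0 < a.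
  by rewrite /a mulr_gt0 ?mulr_gt0 ?exprn_gt0 //; lra.
have a_le gap : eps * OPT / 3 < gap ->
    a / gap ^+ 2 <= 10368 * (D ^+ 2 / OPT ^+ 2 * ln_n / eps ^+ 2).
  move=> gap_gt; have eO_gt0 : 0 < eps * OPT / 3 by rewrite divr_gt0 // mulr_gt0.
  have -> : 10368 * (D ^+ 2 / OPT ^+ 2 * ln_n / eps ^+ 2) = a / (eps * OPT / 3) ^+ 2.
    by rewrite /a; field; rewrite !gt_eqF.
  rewrite ler_pM2l // lef_pV2 ?posrE ?exprn_gt0 //; last exact: lt_trans gap_gt.
  by rewrite lerXn2r ?nnegrE ?ltW //; exact: lt_trans gap_gt.
have opt_bounds m' L U : searching m' L U ->
    [/\ 0 <= L, L < U, U <= 2 * D, L <= OPT & OPT <= U].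
  move=> [_ _ _ _ [_ _ m'_search]].
  have [z_feas z_ge p_feas p_le [? ? ?]] := search_correct n1_gt0 n2_gt0 D_gt0 m'_search.
  split=> //.
    by apply: (le_trans z_ge); apply: svm_ub; exists (svm_out m').
  by apply: le_trans p_le; apply: pd_lb; exists (pd_out m').
(* The total number [N] of iterations stays below [b] whatever the number of rounds, so [B - N] is a
   variant; it decreases because each round has T > 0. *)
pose b := 10368 * (D ^+ 2 / OPT ^+ 2 * ln_n / eps ^+ 2).
have [B b_lt] : exists B : nat, b < B%:R.
  by exists (Num.bound b); apply: le_lt_trans (ler_norm b) (unstable.ltr_norm_bound b).
pose I k m' w' s' := exists L U N, searching m' L U /\
  [/\ eps * OPT / 3 < U - L, N.+1%:R <= a / (U - L) ^+ 2, k = (B - N)%N,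
      (w' <= w + N * phase_work.+1)%N & (s' <= s + N * phase_span.+1)%N].
apply: (@wp_while _ _ _ _ I).
- move=> k m' w' s' [L [U [N [m'_s [gap_gt N_le -> w'_le s'_le]]]]] /=.
  have [L_ge0 LU U_le L_le U_ge] := opt_bounds _ _ _ m'_s.
  have [_ _ _ _ [-> -> _]] := m'_s => gap_gt'.
  apply: wp_phase => //; first exact: m'_s.
  move=> m2 L2 U2 T w2 s2 m2_s gapE T_gt0 T_le w2_le s2_le.
  have gap2_gt : eps * OPT / 3 < U2 - L2 by rewrite gapE; exact: gap_lower.
  have N2_le : (N + T).+1%:R <= a / (U2 - L2) ^+ 2.
    have -> : a / (U2 - L2) ^+ 2 = 9 / 4 * (a / (U - L) ^+ 2).
      by rewrite gapE; field; rewrite gt_eqF // subr_gt0.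
    by rewrite -addSn natrD; exact: potential_step.
  exists (B - (N + T))%N.
    have : (N + T).+1%:R < B%:R :> R.
      by apply: le_lt_trans b_lt; exact: le_trans (a_le _ gap2_gt).
    by rewrite ltr_nat => NT_lt; clear -NT_lt T_gt0; lia.
  exists L2, U2, (N + T)%N; split=> //.
  by split=> //; [exact: chain_cost w2_le | exact: chain_cost s2_le].
- move=> k m' w' s' [L [U [N [m'_s [gap_gt N_le _ w'_le s'_le]]]]] /=.
  have [L_ge0 LU U_le L_le U_ge] := opt_bounds _ _ _ m'_s.
  have [_ _ _ _ [-> -> m'_search]] := m'_s => gap_le.
  apply: (Km _ _ _ N).
  + by exists L, U; split=> //; apply: (le_trans gap_le); rewrite ler_pM2l.
  + exact: le_trans N_le (a_le _ gap_gt).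
  + by rewrite addnS ltnS.
  + by rewrite addnS ltnS.
- have [_ _ U_le _ U_ge] := opt_bounds _ _ _ m_start.
  exists 0, (2 * D), 0%N; split=> //; rewrite subr0 !mul0n !addn0; split=> //.
    exact: gap_start.
  (* The initial potential is 288 ln n, which is at least 1. *)
  rewrite ler_pdivlMr ?exprn_gt0 ?mulr_gt0 // /a exprMn.
  by rewrite mul1r (mulrAC 1152) ler_pM2r ?exprn_gt0 //; lra.
Qed.

(** The maximum is described as a bound that is attained, the two properties that each step of the
    tree of maxima preserves. *)
Lemma max_norm_max : [/\ forall j : 'I_n,
    Num.sqrt (\sum_(i < d) augmented P Q i j * augmented P Q i j) <= D
  & exists j : 'I_n,
    Num.sqrt (\sum_(i < d) augmented P Q i j * augmented P Q i j) = D].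
Proof.
have colP (j : 'I_n1) :
    Num.sqrt (\sum_(i < d) augmented P Q i j * augmented P Q i j) = enorm (col j P).
  by congr Num.sqrt; apply: eq_bigr => i _; rewrite augmentedP !mxE.
have colQ (j : 'I_n2) :
    Num.sqrt (\sum_(i < d) augmented P Q i (n1 + j) * augmented P Q i (n1 + j))
    = enorm (col j Q).
  by congr Num.sqrt; apply: eq_bigr => i _; rewrite augmentedQ !mxE mulrNN.
split.
  move=> j; rewrite -[j]splitK; case: (split j) => k /=.
    by rewrite colP enorm_colP.
  by rewrite colQ enorm_colQ.
have [jP _ PE] := @eq_bigmax _ _ _ 0 (Ordinal n1_gt0) xpredT
  (fun j => enorm (col j P)) isT (fun j _ => enorm_ge0 _).
have [jQ _ QE] := @eq_bigmax _ _ _ 0 (Ordinal n2_gt0) xpredT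
  (fun j => enorm (col j Q)) isT (fun j _ => enorm_ge0 _).
rewrite /max_norm PE QE; case: leP => _.
  by exists (rshift _ jQ); rewrite /= colQ.
by exists (lshift _ jP); rewrite /= colP.
Qed.

Definition initialize_work : nat := (d.+2 * n + sums_work n d + 5 * n + 5)%N.
Definition initialize_span : nat := (sums_span d + 4 * depth n + 7)%N.

Lemma wp_initialize K :
    (forall m' w' s', searching m' 0 (2 * D) -> (w' <= initialize_work)%N ->
       (s' <= initialize_span)%N -> K m' w' s') ->
  wp (initialize d n1 n2) K (fun=> 0) 0 0.
Proof.
move=> Km.
apply: wp_seq; apply: wp_vec => [i j _ _|i j i' j' _ _ _ _|k1 k1A _ k1F].
- exact: entry_defined.
- by rewrite entry_reads.
apply: wp_seq; apply: wp_sums => // k2 k2R k2F w2 w2_le.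
have {k2R} k2R j : (j < n)%N ->
    k2 (rR, 0, j)%N = \sum_(i < d) augmented P Q i j * augmented P Q i j.
  move=> jn; rewrite k2R //; apply: eq_bigr => i _ /=.
  by rewrite k1A ?entry_value //; exact/leqW/leqW/ltn_ord.
apply: wp_seq; apply: wp_vec => // [i j _ jn|k3 k3X _ k3F].
  by rewrite /= k2R //; apply: sumr_ge0 => k _; rewrite -expr2 sqr_ge0.
have [D_ub D_at] := max_norm_max.
pose Inv (_ k : nat) (u : nat -> R) :=
  (forall j, (j < k)%N -> u j <= D) /\ exists2 j, (j < k)%N & u j = D.
apply: wp_seq; apply: (@wp_reduce _ _ _ _ [:: rX; rY; rZ] rX 1 4 Num.max Inv) => //.
- by move=> k m w s K' k_gt1 Km'; apply: wp_max_step.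
- move=> i0 k u v k_gt1 vlo vhi [u_le [j jk uj]]; have kE := uphalfE k; split.
    move=> i ik; have [ilo|ihi] := ltnP i k./2.
      by rewrite vlo // ge_max !u_le //; lia.
    by rewrite vhi // u_le //; lia.
  have [jh|jh] := ltnP j (uphalf k).
    exists j => //; have [jlo|jhi] := ltnP j k./2; last by rewrite vhi.
    by rewrite vlo // uj; apply/max_idPl; apply: u_le; lia.
  exists (j - uphalf k)%N; first by lia.
  rewrite vlo; last by lia.
  by rewrite subnK // uj; apply/max_idPr; apply: u_le; lia.
- by rewrite leqnn addn_gt0 n1_gt0.
- move=> i i1; rewrite (_ : i = 0%N); last by lia.
  split=> [j jn|]; first by rewrite k3X //= k2R // (D_ub (Ordinal jn)).
  by have [j jE] := D_at; exists j => //; rewrite k3X //= k2R.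
move=> k4 /(_ 0%N isT) [_ [[|//] _ k4X]] k4F.
do 4!(apply: wp_seq; apply: wp_assign => //); apply: wp_assign => //.
set m' := upd _ _ _; apply: Km; last 2 first.
- by rewrite /initialize_work; move: w2_le; lia.
- by rewrite /initialize_span /depth; lia.
have k4A i j : k4 (rA, i, j) = k1 (rA, i, j) by rewrite k4F // k3F // k2F.
have k4_0 b i j : b \notin [:: rA; rX; rY; rZ; rR] -> k4 (b, i, j) = 0.
  by case: b => // _; rewrite k4F // k3F // k2F // k1F.
have m'Q j : m' (rQ, 0, j)%N = ((j == 0) || (j == n1))%N%:R.
  rewrite /m' /upd /= !xpair_eqE /= addr0 k4_0 //.
  by case: (j == n1); case: (j == 0)%N.
have outE : svm_out m' = SvmPoint 0 0 0.
  have m'O j : m' (rO, 0, j)%N = 0 by rewrite /m' /upd /= k4_0.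
  by congr SvmPoint => //; apply/colP => i; rewrite !mxE.
have pd_feas : pd_feasible (pd_out m').
  split=> [||j|j]; rewrite ?mxE ?m'Q ?ler0n //; rewrite /entry_sum.
  - rewrite (bigD1 (Ordinal n1_gt0)) //= mxE m'Q /= big1 ?addr0 // => j j_neq0.
    rewrite mxE m'Q (ltn_eqF (ltn_ord j)) orbF.
    by case: eqP => // j0; case/eqP: j_neq0; exact: val_inj.
  - rewrite (bigD1 (Ordinal n2_gt0)) //= mxE m'Q /= addn0 eqxx orbT.
    rewrite big1 ?addr0 // => j j_neq0.
    rewrite mxE m'Q addn_eq0 (gtn_eqF n1_gt0) /= -[X in _ == X]addn0 eqn_add2l.
    by case: eqP => // j0; case/eqP: j_neq0; exact: val_inj.
have m'_search := SearchInit P Q pd_feas; rewrite -outE in m'_search.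
split; last split=> //; rewrite /m' /upd /= ?k4X ?k4_0 ?addr0 ?mulr0 ?subr0 //.
- by move=> i j ie jn /=; rewrite k4A k1A // entry_value.
- by rewrite mulr2n mulrDl mul1r.
- by rewrite mulr2n mulrDl mul1r.
Qed.

End Meta.

(** * Work and span *)

(** As 2 ^ depth k <= 2 k <= q^3 and ln 2 >= 1/2, the depth is at most 2 * 3 ln q. The cube leaves
    room for k = d + 2 with q = n d as small as 2. *)
Lemma depth_le_ln (R : realType) (k q : nat) : (0 < k)%N -> (1 < q)%N ->
  (2 * k <= q ^ 3)%N -> (depth k)%:R <= 6 * ln q%:R :> R.
Proof.
move=> k_gt0 q_gt1 kq; have ln2_ge := @half_le_ln R 2 isT.
have q_gt0 : 0 < q%:R :> R by rewrite ltr0n ltnW.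
have : ln ((2 ^ depth k)%N%:R : R) <= ln ((q ^ 3)%N%:R : R).
  rewrite ler_ln ?posrE ?ltr0n ?expn_gt0 ?(ltnW q_gt1) // ler_nat.
  exact: leq_trans (depth_le k_gt0) kq.
rewrite !natrX !lnXn // -[_ *+ depth k]mulr_natl -[ln q%:R *+ 3]mulr_natl.
have depth_ge0 : 0 <= (depth k)%:R :> R by [].
have := ler_wpM2l depth_ge0 ln2_ge. lra.
Qed.

Lemma total_work_le (d n1 n2 : nat) : (0 < d)%N -> (0 < n1 + n2)%N ->
  (phase_work d n1 n2 + initialize_work d n1 n2 + 2 <= 300 * ((n1 + n2) * d))%N.
Proof.
rewrite /phase_work /initialize_work /iteration_work /weigh_work /direct_work /sums_work.
set n := (n1 + n2)%N => d_gt0 n_gt0.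
have := leq_pmulr n d_gt0; have := leq_pmull d n_gt0.
have [-> -> ->] : [/\ (d.+2 * n = n * d + 2 * n)%N, (n * d.+2 = n * d + 2 * n)%N
  & (2 * (n * d) = n * d + n * d)%N] by split; lia.
lia.
Qed.

Lemma total_span_le (R : realType) (d n1 n2 : nat) : (0 < d)%N -> (1 < n1 + n2)%N ->
  (phase_span d n1 n2 + initialize_span d n1 n2 + 2)%:R
    <= 300 * ln ((n1 + n2) * d)%N%:R :> R.
Proof.
set n := (n1 + n2)%N => d_gt0 n_gt1; set q := (n * d)%N.
have n_le : (n <= q)%N by exact: leq_pmulr.
have q_gt1 : (1 < q)%N by exact: leq_trans n_le.
have d2_le : (2 * d <= q)%N by rewrite leq_mul2r n_gt1 orbT.
have q2_ge : (2 * q <= q ^ 2)%N by rewrite -mulnn leq_mul2r q_gt1 orbT.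
have q3_ge : (4 * q <= q ^ 3)%N.
  apply: (@leq_trans (2 * q ^ 2)%N).
    by rewrite -[4%N]/(2 * 2)%N -mulnA leq_mul2l.
  by rewrite (expnS q 2) leq_mul2r q_gt1 orbT.
clearbody q; have depth_n : (depth n)%:R <= 6 * ln q%:R :> R by apply: depth_le_ln; lia.
have depth_d : (depth d)%:R <= 6 * ln q%:R :> R by apply: depth_le_ln; lia.
have depth_d2 : (depth d.+2)%:R <= 6 * ln q%:R :> R by apply: depth_le_ln; lia.
have ln_ge := half_le_ln R q_gt1.
(* Nine depths give at most 54 ln q, and 77 <= 154 ln q. *)
have -> : (phase_span d n1 n2 + initialize_span d n1 n2 + 2
    = 5 * depth n + 2 * depth d + 2 * depth d.+2 + 77)%N.
  rewrite /phase_span /initialize_span /iteration_span /weigh_span /direct_span.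
  by rewrite /sums_span -/n; lia.
rewrite !natrD !natrM; lra.
Qed.

Lemma operand_regs_outputs (d n1 n2 : nat) (k : sol_index d n1 n2) :
  {subset operand_regs (outputs k) <= cells rO 1 d.+2 ++ cells rQ 1 (n1 + n2)}.
Proof.
move=> r; rewrite mem_cat; case: k => [i|||j|j];
  rewrite inE => /eqP->; rewrite !mem_cells /=.
- by rewrite (leqW (leqW (ltn_ord i))).
- by rewrite ltnS leqnSn.
- by rewrite ltnSn.
- by rewrite (leq_trans (ltn_ord j)) // leq_addr.
- by rewrite ltn_add2l ltn_ord.
Qed.

Theorem theorem9 (R : realType) :
  exists (C : R)
         (alg : forall d n1 n2 : nat,
                  program (svm_index d n1 n2) (sol_index d n1 n2)),
    0 < C /\
    forall (d n1 n2 : nat) (P : 'M[R]_(d, n1)) (Q : 'M[R]_(d, n2)) (OPT eps : R),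
      (0 < n1)%N -> (0 < n2)%N ->
      svm_optimum P Q OPT -> pd_optimum P Q OPT ->
      0 < OPT ->
      0 < eps <= 1 ->
      let n := (n1 + n2)%N in
      let E := max_norm P Q ^+ 2 / OPT ^+ 2 in
      exists (y : sol_index d n1 n2 -> R) (g : dag),
        [/\ computes (alg d n1 n2) (svm_input P Q eps) y g,
            meta_algorithm P Q OPT eps (svm_output y) (pd_output y),
            svm_approx P Q OPT eps (svm_output y) /\
            pd_approx P Q OPT eps (pd_output y),
            (dag_work g)%:R <= C * (E * (n * d)%:R * ln n%:R / eps ^+ 2)
          & (dag_span g)%:R <= C * (E * ln (n * d)%:R * ln n%:R / eps ^+ 2)].
Proof.
(* 10368 comes from the number of iterations, 300 from the cost charged to each. *)
exists (10368 * 300), meta_program; split; first by rewrite mulr_gt0.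
move=> d n1 n2 P Q OPT eps n1_gt0 n2_gt0 svm_opt pd_opt OPT_gt0 eps_bnd n E.
have [[p p_feas p_val] _] := pd_opt.
(* OPT is the value of a feasible point of (PD), so 0 < OPT <= 2 D. *)
have D_gt0 : 0 < max_norm P Q.
  by have := pd_value_le P Q p_feas; rewrite p_val; lra.
(* In dimension zero every norm vanishes, against OPT > 0. *)
have d_gt0 : (0 < d)%N.
  case: d P Q p_val {svm_opt pd_opt p_feas D_gt0 E} => // P Q p_val.
  by move: OPT_gt0; rewrite -p_val /pd_value /enorm big_ord0 sqrtr0 ltxx.
have n_gt1 : (1 < n)%N by rewrite /n -(addn1 1) leq_add.
pose b := E * ln n%:R / eps ^+ 2.
pose post (m : reg -> R) w s := exists N,
  [/\ meta_algorithm P Q OPT eps (svm_out d m) (pd_out n1 n2 m), N.+1%:R <= 10368 * b,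
      (w <= N.+1 * (phase_work d n1 n2 + initialize_work d n1 n2 + 2))%N
    & (s <= N.+1 * (phase_span d n1 n2 + initialize_span d n1 n2 + 2))%N].
have main_post : wp (svm_input P Q eps) (main d n1 n2) post (fun=> 0) 0 0.
  apply: wp_seq; apply: wp_initialize => // m w s m_start w_le s_le.
  apply: (wp_search d_gt0 n1_gt0 n2_gt0 D_gt0 (OPT := OPT)) => // m' w' s' N.
  move=> m'_meta N_le w'_le s'_le.
  by exists N; split=> //; [exact: total_cost w_le w'_le | exact: total_cost s_le s'_le].
have [m [g [comp [w [s [[N [m_meta N_le w_le s_le]] work_le span_le]]]]]] :=
  computes_wp (@operand_regs_outputs d n1 n2) main_post.
have bound (c k : nat) (x : R) : (k <= N.+1 * c)%N -> c%:R <= 300 * x ->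
    k%:R <= 10368 * 300 * (b * x).
  move=> k_le c_le; apply: (@le_trans _ _ (N.+1 * c)%N%:R); first by rewrite ler_nat.
  rewrite natrM; apply: (@le_trans _ _ (10368 * b * (300 * x))); first exact: ler_pM.
  by rewrite le_eqVlt; apply/orP; left; apply/eqP; ring.
exists (fun k => value (svm_input P Q eps) m (outputs k)), g; split=> //.
- exact: meta_algorithm_correct m_meta.
- have -> : E * (n * d)%N%:R * ln n%:R / eps ^+ 2 = b * (n * d)%N%:R by rewrite /b; ring.
  apply: (bound _ _ _ (leq_trans work_le w_le)).
  by rewrite -natrM ler_nat; apply: total_work_le => //; exact: ltnW.
- have -> : E * ln (n * d)%N%:R * ln n%:R / eps ^+ 2 = b * ln (n * d)%N%:R.
    by rewrite /b; ring.
  by apply: (bound _ _ _ (leq_trans span_le s_le)); exact: total_span_le.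
Qed.
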